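(* Let $\mathbf{M}=(\Omega,\mathcal{F},\mathbb{F},P,Y,S)$ and $\tilde{\mathbf{M}}=(\tilde\Omega,\tilde{\mathcal{F}},\tilde{\mathbb{F}},\tilde P,\tilde Y,\tilde S)$ be two market models such that the laws coincide: $\mathcal{L}_P(S,Y)=\mathcal{L}_{\tilde P}(\tilde S,\tilde Y)$. Then for every $x\in K$, $$u(x,\mathbf{M})=u(x,\tilde{\mathbf{M}}).$$
   Context: Fix $p,d\in\mathbb{N}$, $T\in\mathbb{R}_{++}:=(0,\infty)$. Let $\mathcal{D}^d_T$ be the space of all RCLL (right-continuous with left limits) functions $f:[0,T]\to\mathbb{R}^d$. Fix a closed convex cone $K\subset\mathbb{R}^d$ that is proper, i.e. $K\cap(-K)=\{0\}$, and such that $\mathbb{R}^d_{++}\subset K$. Fix a utility function $U:K\to\mathbb{R}\cup\{-\infty\}$ (it is implicit that $U$ is Borel and that the expectations below make sense). The objects $p,d,T,K,U$ are the same for both models. Market model. A model $\mathbf{M}=(\Omega,\mathcal{F},\mathbb{F},P,Y,S)$ consists of a stochastic basis $(\Omega,\mathcal{F},\mathbb{F}=(\mathcal{F}_t)_{t\in[0,T]},P)$, an $\mathbb{R}^p$-valued process $Y$ with RCLL paths such that the filtration $\mathbb{F}$ is generated by $Y$ and the null sets of $\mathcal{F}$, and an $\mathbb{R}^d_{++}$-valued $\mathbb{F}$-adapted process $S=(S^1,\dots,S^d)$ with continuous paths, $S_0=(1,\dots,1)$ and $S^1\equiv 1$. Strategies. A function $f:[0,T]\to\mathbb{R}^d$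 is $K$-increasing if $f(t)-f(s)\in K$ for all $0\le s\le t\le T$, and $K$-decreasing if it is $(-K)$-increasing. $\mathcal{H}_K$ is the set of all $K$-decreasing paths in $\mathcal{D}^d_T$. A strategy is an adapted process $B=(B_t)_{t\in[0,T]}$ with paths in $\mathcal{H}_K$ (such paths are of finite variation). Wealth. For an initial value $x\in K$ and a strategy $B$, put $\widehat V^j_t:=x^j+\int_{[0,t]}\frac{1}{S^j_s}\,dB^j_s$ (Riemann–Stieltjes integral, with the convention $B_{0-}=0$, so that the integrator has the mass $B_0$ at time $0$), and $V^{x,B,j}_t:=S^j_t\widehat V^j_t$, $j=1,\dots,d$. Admissibility and Bellman function. $B$ is admissible if $V^{x,B}_t\in K$ a.s. for every $t\in[0,T]$; $\mathcal{A}(x)$ is the class of admissible strategies in the given model. The Bellman function of the model is $u(x)=u(x,\mathbf{M}):=\sup_{B\in\mathcal{A}(x)}\mathbf{E}\,U(V^{x,B}_T)$, the expectation being under the probability measure of the model. *)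

(* Defs.v *)
From HB Require Import structures.
From mathcomp Require Import all_boot all_order all_algebra.
From mathcomp Require Import all_classical all_reals all_analysis.
From mathcomp Require Import measurable_realfun.

Set Implicit Arguments.
Unset Strict Implicit.
Unset Printing Implicit Defensive.

Import Order.TTheory GRing.Theory Num.Theory.
Import numFieldNormedType.Exports.

Local Open Scope classical_set_scope.
Local Open Scope ring_scope.

(* A path [0, T] -> R^n is encoded by a function on R of which only the values
   on [0, T] are ever used; R^n is 'rV[R]_n. *)

Definition borel (R : realType) (n : nat) : set_system 'rV[R]_n :=
  <<s @open 'rV[R]_n >>.

Definition borel_rV (R : realType) (n : nat) :=
  g_sigma_algebraType (@open 'rV[R]_n).

Definition convex_cone (R : realType) (d : nat) (K : set 'rV[R]_d) : Prop :=
  @convex_set R 'rV[R]_d K /\ (forall (a : R) v, 0 < a -> K v -> K (a *: v)).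

Definition proper_cone (R : realType) (d : nat) (K : set 'rV[R]_d) : Prop :=
  K `&` [set v | K (- v)] = [set 0].

Definition rcll (R : realType) (n : nat) (T : R) (f : R -> 'rV[R]_n) : Prop :=
  (forall t : R, 0 <= t < T -> f @ t^'+ --> f t) /\
  (forall t : R, 0 < t <= T -> cvg (f @ t^'-)).

Definition cone_increasing (R : realType) (d : nat) (T : R)
    (K : set 'rV[R]_d) (f : R -> 'rV[R]_d) : Prop :=
  forall s t : R, 0 <= s -> s <= t -> t <= T -> K (f t - f s).

Definition cone_decreasing (R : realType) (d : nat) (T : R)
    (K : set 'rV[R]_d) (f : R -> 'rV[R]_d) : Prop :=
  cone_increasing T [set v | K (- v)] f.

(* There is no constraint on the initial value f 0. *)
Definition cone_decreasing_paths (R : realType) (d : nat) (T : R)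
    (K : set 'rV[R]_d) : set (R -> 'rV[R]_d) :=
  [set f | rcll T f /\ cone_decreasing T K f].

(* [s] lists the points of the partition other than its left end [a], and
   [xi n] is the tag of the n-th cell. *)
Definition RS_sum (R : realType) (a : R) (s : seq R) (xi : nat -> R)
    (g f : R -> R) : R :=
  \sum_(0 <= n < size s) g (xi n) * (f (nth 0 s n) - f (nth 0 (a :: s) n)).

Definition is_RS_integral (R : realType) (a b : R) (g f : R -> R) (I : R) :
    Prop :=
  forall e : R, 0 < e -> exists2 delta : R, 0 < delta &
    forall (s : seq R) (xi : nat -> R), itv_partition a b s ->
      (forall n, (n < size s)%N ->
        nth 0 s n - nth 0 (a :: s) n < delta /\
        nth 0 (a :: s) n <= xi n <= nth 0 s n) ->
      `|RS_sum a s xi g f - I| < e.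

(* The integral exists whenever g is continuous and f of finite variation on
   [a, b], which is the only case of interest; 0 is a junk value. *)
Definition RS_integral (R : realType) (a b : R) (g f : R -> R) : R :=
  xget 0 [set I | is_RS_integral a b g f I].

(* The integral over the closed interval [0, t] with f(0-) = 0: the integrator
   has the mass f 0 at time 0. *)
Definition RS_integral0 (R : realType) (t : R) (g f : R -> R) : R :=
  g 0 * f 0 + RS_integral 0 t g f.

Definition filtration_of (R : realType) (p : nat) (disp : measure_display)
    (Omega : measurableType disp) (P : probability Omega R)
    (Y : Omega -> R -> 'rV[R]_p) (t : R) : set_system Omega :=
  <<s [set E | exists (s : R) A,
         [/\ 0 <= s <= t, borel A & E = [set w | A (Y w s)]]] `|`
      [set N | measurable N /\ P N = 0%E] >>.

Definition adapted (R : realType) (n : nat) (T : R) (Omega : Type)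
    (Ft : R -> set_system Omega) (X : Omega -> R -> 'rV[R]_n) : Prop :=
  forall t : R, 0 <= t <= T -> forall A, borel A -> Ft t [set w | A (X w t)].

Record market_model (R : realType) (p d : nat) (T : R) := MarketModel {
  disp : measure_display;
  Omega : measurableType disp;
  filtration : R -> set_system Omega;
  prob : probability Omega R;
  driving : Omega -> R -> 'rV[R]_p;
  price : Omega -> R -> 'rV[R]_d;
  driving_measurable : adapted T (fun=> measurable) driving;
  driving_rcll : forall w, rcll T (driving w);
  filtrationE : forall t : R, 0 <= t <= T ->
    filtration t = filtration_of prob driving t;
  price_adapted : adapted T filtration price;
  price_continuous : forall w, {within `[0, T], continuous (price w)};
  price_gt0 : forall w (t : R) j, 0 <= t <= T -> 0 < price w t ord0 j;
  price_init : forall w j, price w 0 ord0 j = 1;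
  price_numeraire : forall w (t : R) (j : 'I_d),
    j = 0%N :> nat -> 0 <= t <= T -> price w t ord0 j = 1
}.

Arguments filtration {R p d T} m t.

(* The space of paths with the sigma-algebra generated by the evaluations at
   the times in [0, T]; its traces on the continuous and on the RCLL paths are
   the Borel sigma-algebras of the uniform and of the Skorokhod topology. *)
Definition cylinders (R : realType) (n : nat) (T : R) :
    set_system (R -> 'rV[R]_n) :=
  [set C | exists (t : R) A, [/\ 0 <= t <= T, borel A & C = [set f | A (f t)]]].

Definition path_space (R : realType) (n : nat) (T : R) :=
  g_sigma_algebraType (@cylinders R n T).

Definition model_law (R : realType) (p d : nat) (T : R)
    (M : market_model p d T) :
    set (path_space d T * path_space p T) -> \bar R :=
  pushforward (prob M)
    (fun w => (price w, driving w) : path_space d T * path_space p T).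

Definition same_law (R : realType) (p d : nat) (T : R)
    (M M' : market_model p d T) : Prop :=
  forall A : set (path_space d T * path_space p T), measurable A ->
    model_law M A = model_law M' A.

Definition strategy (R : realType) (p d : nat) (T : R) (K : set 'rV[R]_d)
    (M : market_model p d T) (B : Omega M -> R -> 'rV[R]_d) : Prop :=
  adapted T (filtration M) B /\
  forall w, cone_decreasing_paths T K (B w).

Definition normalized_wealth (R : realType) (p d : nat) (T : R)
    (M : market_model p d T) (x : 'rV[R]_d) (B : Omega M -> R -> 'rV[R]_d)
    (w : Omega M) (t : R) : 'rV[R]_d :=
  \row_j (x ord0 j +
          RS_integral0 t (fun s => (price w s ord0 j)^-1)
                         (fun s => B w s ord0 j)).

Definition wealth (R : realType) (p d : nat) (T : R)
    (M : market_model p d T) (x : 'rV[R]_d) (B : Omega M -> R -> 'rV[R]_d)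
    (w : Omega M) (t : R) : 'rV[R]_d :=
  \row_j (price w t ord0 j * normalized_wealth x B w t ord0 j).

Definition admissible (R : realType) (p d : nat) (T : R) (K : set 'rV[R]_d)
    (M : market_model p d T) (x : 'rV[R]_d) :
    set (Omega M -> R -> 'rV[R]_d) :=
  [set B | @strategy R p d T K M B /\
    forall t : R, 0 <= t <= T -> {ae prob M, forall w, K (wealth x B w t)}].

Arguments admissible {R p d T} K M x.

(* U is meaningful on K only, hence the domain of integration, an event of
   probability 1 for every admissible B.  The Lebesgue integral is
   \int U^+ - \int U^-, with +oo - +oo = -oo. *)
Definition expected_utility (R : realType) (p d : nat) (T : R)
    (K : set 'rV[R]_d) (U : 'rV[R]_d -> \bar R) (M : market_model p d T)
    (x : 'rV[R]_d) (B : Omega M -> R -> 'rV[R]_d) : \bar R :=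
  (\int[prob M]_(w in [set w | K (wealth x B w T)]) U (wealth x B w T))%E.

Definition bellman (R : realType) (p d : nat) (T : R) (K : set 'rV[R]_d)
    (U : 'rV[R]_d -> \bar R) (x : 'rV[R]_d) (M : market_model p d T) : \bar R :=
  ereal_sup [set expected_utility K U x B | B in admissible K M x].

(* Main.v *)
Require Import Defs.
From mathcomp Require Import all_boot all_order all_algebra.
From mathcomp Require Import all_classical all_reals all_analysis.
From mathcomp Require Import measurable_realfun.
From mathcomp Require Import ring lra.

Set Implicit Arguments.
Unset Strict Implicit.
Unset Printing Implicit Defensive.

Import Order.TTheory GRing.Theory Num.Theory.
Import numFieldNormedType.Exports.

Local Open Scope classical_set_scope.
Local Open Scope ring_scope.

(* The driving process Y generates the filtration up to null sets, so at each
   dyadic time q a strategy B equals almost surely a measurable function beta_q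
   of the path of Y.  Off a set of paths of law 0 these functions are
   K-decreasing in q, and because order intervals of a proper closed cone are
   bounded, the right limits along dyadic times form an RCLL K-decreasing path
   b(Y), equal to B off a null set by right continuity.  Feeding the path of Y'
   to the same b gives a strategy of M'; it is adapted to F' itself, not just to
   the right-continuous filtration, because B_t is F_t-measurable and it is a
   property of the law of Y that b(Y)_t is almost surely a function of Y up to
   time t.  The wealth is the limit of Riemann sums, hence a measurable function
   of (S, b(Y)), so admissibility and expected utility depend only on the law of
   (S, Y). *)

(** * Closed proper convex cones *)

Lemma cone_add (R : realType) (d : nat) (K : set 'rV[R]_d) (u v : 'rV[R]_d) :
  convex_cone K -> K u -> K v -> K (u + v).
Proof.
move=> [cK sK] Ku Kv.
have h0 : (0 : R) <= 2^-1 by rewrite invr_ge0.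
have h1 : (2^-1 : R) <= 1 by lra.
have := cK u v (Itv01 h0 h1); rewrite !inE => /(_ Ku Kv) Kuv.
have -> : u + v = 2 *: (2^-1 *: u + (1 - 2^-1) *: v).
  have -> : (1 - 2^-1) = 2^-1 :> R by lra.
  by rewrite -scalerDr scalerA mulfV ?scale1r.
by apply: sK.
Qed.

(** [convex_cone] allows scaling by strictly positive factors only, so membership of the origin is
    drawn from properness. *)
Lemma proper_cone0 (R : realType) (d : nat) (K : set 'rV[R]_d) :
  proper_cone K -> K 0.
Proof.
by move=> pK; have : [set 0] (0 : 'rV[R]_d) by []; rewrite -pK => -[].
Qed.

Lemma cone_sum (R : realType) (d : nat) (K : set 'rV[R]_d) (I : Type)
    (r : seq I) (P : pred I) (v : I -> 'rV[R]_d) :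
  convex_cone K -> proper_cone K -> (forall i, P i -> K (v i)) ->
  K (\sum_(i <- r | P i) v i).
Proof.
move=> cK pK Kv; elim/big_ind : _ => //; first exact: proper_cone0.
by move=> a b; exact: cone_add.
Qed.

Lemma ler_entry_norm (R : realType) (d : nat) (v : 'rV[R]_d) (j : 'I_d) :
  `|v ord0 j| <= `|v|.
Proof.
rewrite [leRHS]/Num.norm /= mx_normrE; apply/bigmax_geP; right.
by exists (ord0, j).
Qed.

(* On the compact set of unit vectors of K the distance to the closed set -K
   is bounded below. *)
Lemma cone_normal (R : realType) (d : nat) (K : set 'rV[R]_d) :
  closed K -> convex_cone K -> proper_cone K ->
  exists2 C : R, 0 < C & forall u v, K u -> K v -> `|u| <= C * `|u + v|.
Proof.
move=> clK cK pK.
pose A := K `&` [set u : 'rV[R]_d | `|u| = 1].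
have cA : compact A.
  apply: bounded_closed_compact.
    exists 1; split; first exact: num_real.
    by move=> M M1 u [_ /= ->]; exact: ltW.
  apply: closedI => //.
  apply: (@preimage_closed _ _ (fun u : 'rV[R]_d => `|u|) [set 1]).
    by move=> u _; exact: norm_continuous.
  exact: closed_eq.
have [e e0 he] : exists2 e : R, 0 < e & forall u v, A u -> K v -> e <= `|u + v|.
  have nA : forall u, A u -> \forall u' \near u & e \near (0 : R)^'+,
      A u' -> forall v, K v -> e <= `|u' + v|.
    move=> u Au.
    have : nbhs u (~` [set v | K (- v)]).
      apply: open_nbhs_nbhs; split.
        apply: closed_openC.
        apply: (@preimage_closed _ _ (fun u : 'rV[R]_d => - u) K) => //.
        by move=> w _; exact: opp_continuous.
      move=> /= KNu.
      have [Ku /= u1] := Au.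
      have : (K `&` [set v | K (- v)]) u by [].
      rewrite pK => /= u0; move: u1; rewrite u0 normr0 => /eqP.
      by rewrite eq_sym oner_eq0.
    move=> /nbhs_ballP [r /= r0 hr].
    exists (ball u (r / 2), [set e | e < r / 2]) => /=.
      split; first by apply: nbhsx_ballx; rewrite divr_gt0.
      by near=> z; rewrite /=; near: z; apply: nbhs_right_lt; rewrite divr_gt0.
    move=> [u' e'] /= [bu le] _ v Kv; rewrite leNgt; apply/negP => lt.
    (* If [u' + v] were shorter than [e'], then [- v] would fall into the ball around [u] that
       avoids [-K]. *)
    have /(hr _) : ball u r (- v).
      rewrite -ball_normE /= opprK.
      have -> : u + v = (u - u') + (u' + v) by rewrite addrA subrK.
      rewrite (le_lt_trans (ler_normD _ _))// [ltRHS]splitr ltrD//.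
        by rewrite -ball_normE in bu.
      exact: lt_trans le.
    by rewrite /= opprK.
  move/compact_near_coveringP: cA => /(_ R (0^'+) (fun e u =>
    A u -> forall v, K v -> e <= `|u + v|) _ nA) h.
  have : \forall e \near (0 : R)^'+, 0 < e by exact: nbhs_right_gt.
  move=> h0.
  have [e [h1 h2]] := @filter_ex _ ((0 : R)^'+) _ _ (filterI h h0).
  by exists e => // u v Au; apply: h1.
(* By homogeneity: dividing [u] and [v] by the norm of [u] moves [u] into [A], where [e] is a lower
   bound. *)
exists e^-1; first by rewrite invr_gt0.
move=> u v Ku Kv; rewrite ler_pdivlMl//.
have [->|u0] := eqVneq u 0; first by rewrite normr0 mulr0.
have nu0 : 0 < `|u| by rewrite normr_gt0.
have := he (`|u|^-1 *: u) (`|u|^-1 *: v).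
rewrite -scalerDr !normrZ normfV normr_id => H.
have : e <= `|u|^-1 * `|u + v|.
  apply: H.
    split; first by apply: cK.2 => //; rewrite invr_gt0.
    by rewrite /= normrZ normfV normr_id mulVf ?gt_eqF.
  by apply: cK.2 => //; rewrite invr_gt0.
by rewrite ler_pdivlMl// mulrC.
Unshelve. all: by end_near. Qed.
(* The terms with nonnegative j-th entry and the others form two sums P and N in
   K; the left-hand side is the j-th entry of P - N, while P + N is the whole
   sum, so normality bounds both P and N. *)
Lemma cone_variation (R : realType) (d : nat) (K : set 'rV[R]_d) (C : R)
    (n : nat) (v : nat -> 'rV[R]_d) (j : 'I_d) :
  convex_cone K -> proper_cone K ->
  (forall u w, K u -> K w -> `|u| <= C * `|u + w|) ->
  (forall i, (i < n)%N -> K (v i)) ->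
  \sum_(0 <= i < n) `|v i ord0 j| <= 2 * C * `|\sum_(0 <= i < n) v i|.
Proof.
move=> cK pK hC Kv; rewrite !big_mkord.
pose P := \sum_(i < n | 0 <= v i ord0 j) v i.
pose N := \sum_(i < n | ~~ (0 <= v i ord0 j)) v i.
have KP : K P by apply: cone_sum => // i _; exact: Kv.
have KN : K N by apply: cone_sum => // i _; exact: Kv.
have PN : \sum_(i < n) v i = P + N.
  by rewrite (bigID (fun i : 'I_n => 0 <= v i ord0 j)).
have -> : \sum_(i < n) `|v i ord0 j| = P ord0 j - N ord0 j.
  rewrite (bigID (fun i : 'I_n => 0 <= v i ord0 j)) /= !summxE -sumrN.
  congr (_ + _); first by apply: eq_bigr => i /ger0_norm.
  by apply: eq_bigr => i; rewrite -ltNge => /ltW /ler0_norm.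
rewrite PN mulrDl mul1r mulrDl; apply: (le_trans (ler_norm _)).
apply: (le_trans (ler_normB _ _)); apply: lerD.
  exact: le_trans (ler_entry_norm _ _) (hC _ _ KP KN).
by apply: le_trans (ler_entry_norm _ _) _; rewrite addrC; exact: hC.
Qed.

(** The entries need not be monotone, since the order is that of [K]. Their total variation is
    finite by [cone_variation], so the series of their increments converges absolutely. *)
Lemma cone_monotone_cvg (R : realType) (d : nat) (K : set 'rV[R]_d)
    (v : nat -> 'rV[R]_d) (a : 'rV[R]_d) (j : 'I_d) :
  closed K -> convex_cone K -> proper_cone K ->
  (forall n, K (v n - v n.+1)) -> (forall n, K (v n - a)) ->
  cvgn (fun n => v n ord0 j).
Proof.
move=> clK cK pK dv va.
have [C C0 hC] := cone_normal clK cK pK.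
have ub n : \sum_(0 <= i < n) `|v i ord0 j - v i.+1 ord0 j|
    <= 2 * C * (C * `|v 0 - a|).
  have := cone_variation (n := n) j cK pK hC (fun i _ => dv i).
  rewrite -[X in `|X|]opprK -sumrN.
  under eq_bigr do rewrite !mxE.
  under [in X in - X]eq_bigr do rewrite opprB.
  rewrite telescope_sumr// opprB => /le_trans; apply.
  rewrite ler_pM2l ?mulr_gt0//.
  (* Normality a second time: both vectors lie in [K] and add up to [v 0 - a], which makes the bound
     independent of [n]. *)
  have := hC (v 0 - v n) (v n - a); rewrite addrA subrK; apply => //.
  elim: n => [|n IH]; first by rewrite subrr; exact: proper_cone0.
  by rewrite -(subrK (v n) (v 0)) -addrA; apply: cone_add.
pose w n := v n ord0 j.
have -> : (fun n => v n ord0 j) = (fun n => w 0 + series (telescope w) n).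
  by apply/funext => n; rewrite -eq_sum_telescope.
apply: is_cvgD; first exact: is_cvg_cst.
apply: (@normed_cvg R R^o).
apply: nondecreasing_is_cvgn.
  apply/nondecreasing_seqP => n.
  by rewrite /= !seriesEnat /= big_nat_recr//= lerDl.
exists (2 * C * (C * `|v 0 - a|)) => _ [n _ <-] /=.
rewrite seriesEnat /=; apply: le_trans (ub n).
by apply: ler_sum => i _; rewrite /telescope distrC.
Qed.

(** * Riemann-Stieltjes integrals *)

(** Heine-Cantor theorem. Half of the local radius [r] is spent on [x'] and the other half on [y],
    so both stay within [r] of [x]; compactness then makes [del] uniform. *)
Lemma segment_unif_continuous (R : realType) (a b : R) (g : R -> R) :
  {within `[a, b], continuous g} -> forall e : R, 0 < e ->
  exists2 del : R, 0 < del & forall x y, a <= x <= b -> a <= y <= b ->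
    `|x - y| < del -> `|g x - g y| < e.
Proof.
move=> cg e e0.
pose I := `[a, b]%classic.
have cI : compact I by exact: segment_compact.
have nI x : I x -> \forall x' \near x & del \near (0 : R)^'+,
    I x' -> forall y, I y -> `|x' - y| < del -> `|g x' - g y| < e.
  move=> Ix.
  have /(_ x Ix) gx := (subspace_continuousP _ _).1 cg.
  have /(_ _ _)/nbhs_ballP [|r /= r0 hr] :=
    @cvgr_dist_lt _ _ _ _ _ _ _ gx (e / 2).
    by rewrite divr_gt0.
  exists (ball x (r / 2), [set del | del < r / 2]) => /=.
    split; first by apply: nbhsx_ballx; rewrite divr_gt0.
    by near=> z; rewrite /=; near: z; apply: nbhs_right_lt; rewrite divr_gt0.
  move=> [x' del] [/= bx ld] Ix' y Iy xy.
  have h1 : `|g x - g x'| < e / 2.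
    apply: hr => //=; apply: lt_trans bx _; rewrite ltr_pdivrMr// mulr_natr.
    by rewrite mulr2n ltrDl.
  have h2 : `|g x - g y| < e / 2.
    apply: hr => //; rewrite /ball /=.
    have -> : x - y = (x - x') + (x' - y) by rewrite addrA subrK.
    rewrite (le_lt_trans (ler_normD _ _))// [ltRHS]splitr ltrD//.
    exact: lt_trans ld.
  have -> : g x' - g y = - (g x - g x') + (g x - g y).
    by rewrite opprB addrA subrK.
  by rewrite (le_lt_trans (ler_normD _ _))// normrN [ltRHS]splitr ltrD.
move/compact_near_coveringP: cI => /(_ R (0^'+) (fun del x =>
    I x -> forall y, I y -> `|x - y| < del -> `|g x - g y| < e) _ nI) h.
have h0 : \forall del \near (0 : R)^'+, 0 < del by exact: nbhs_right_gt.
have [del [h1 h2]] := @filter_ex _ ((0 : R)^'+) _ _ (filterI h h0).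
exists del => // x y xab yab xy.
by apply: h1 => //; rewrite /I /= in_itv.
Unshelve. all: by end_near. Qed.

(* With m i k the increment of f over the intersection of the i-th cell of p and
   the k-th cell of q, both Riemann sums are double sums against m >= 0. *)
Lemma riemann_sum_compare (R : realType) (f g : R -> R) (a b : R)
    (N M : nat) (p q xi tau : nat -> R) (e del : R) :
  {in `[a, b] &, nondecreasing f} ->
  (forall x y, a <= x <= b -> a <= y <= b -> `|x - y| < del + del ->
    `|g x - g y| <= e) ->
  p 0 = a -> p N = b -> (forall i, (i <= N)%N -> a <= p i <= b) ->
  (forall i, (i < N)%N -> p i <= xi i <= p i.+1 /\ p i.+1 - p i < del) ->
  q 0 = a -> q M = b -> (forall i, (i <= M)%N -> a <= q i <= b) ->
  (forall i, (i < M)%N -> q i <= tau i <= q i.+1 /\ q i.+1 - q i < del) ->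
  `|\sum_(0 <= i < N) g (xi i) * (f (p i.+1) - f (p i)) -
    \sum_(0 <= k < M) g (tau k) * (f (q k.+1) - f (q k))|
    <= e * (f b - f a).
Proof.
move=> ndf hg p0 pN pab hp q0 qM qab hq.
(* The mixed second difference of [f (min x y)]: it telescopes in each index separately and vanishes
   on cells that do not overlap. *)
pose m i k := f (Num.min (p i.+1) (q k.+1)) - f (Num.min (p i) (q k.+1)) -
              (f (Num.min (p i.+1) (q k)) - f (Num.min (p i) (q k))).
have row i : (i < N)%N -> \sum_(0 <= k < M) m i k = f (p i.+1) - f (p i).
  move=> iN.
  rewrite (@telescope_sumr _ 0 M (fun k =>
    f (Num.min (p i.+1) (q k)) - f (Num.min (p i) (q k))))//.
  have /andP[h1 h2] := pab i (ltnW iN); have /andP[h3 h4] := pab i.+1 iN.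
  rewrite qM q0 (min_idPl h2) (min_idPl h4) (min_idPr h1) (min_idPr h3).
  by rewrite subrr subr0.
have col k : (k < M)%N -> \sum_(0 <= i < N) m i k = f (q k.+1) - f (q k).
  move=> kM.
  have -> : \sum_(0 <= i < N) m i k = \sum_(0 <= i < N)
      ((f (Num.min (p i.+1) (q k.+1)) - f (Num.min (p i.+1) (q k))) -
       (f (Num.min (p i) (q k.+1)) - f (Num.min (p i) (q k)))).
    by apply: eq_bigr => i _; rewrite /m; ring.
  rewrite (@telescope_sumr _ 0 N (fun i =>
    f (Num.min (p i) (q k.+1)) - f (Num.min (p i) (q k))))//.
  have /andP[h1 h2] := qab k (ltnW kM); have /andP[h3 h4] := qab k.+1 kM.
  rewrite pN p0 (min_idPr h2) (min_idPr h4) (min_idPl h1) (min_idPl h3).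
  by rewrite subrr subr0.
have term i k : (i < N)%N -> (k < M)%N ->
    `|(g (xi i) - g (tau k)) * m i k| <= e * m i k.
  move=> iN kM.
  have /andP[h1 h2] := pab i (ltnW iN); have /andP[h3 h4] := pab i.+1 iN.
  have /andP[h5 h6] := qab k (ltnW kM); have /andP[h7 h8] := qab k.+1 kM.
  have [/andP[x1 x2] x3] := hp i iN; have [/andP[y1 y2] y3] := hq k kM.
  have pp : p i <= p i.+1 by exact: le_trans x2.
  have qq : q k <= q k.+1 by exact: le_trans y2.
  (* Cells without overlap carry no increment. If they overlap, the increment is nonnegative and the
     two tags are less than [del + del] apart. *)
  have [pq|qp] := leP (p i.+1) (q k).
    suff -> : m i k = 0 by rewrite !mulr0 normr0.
    rewrite /m (min_idPl pq) (min_idPl (le_trans pq qq)).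
    rewrite (min_idPl (le_trans pp pq)).
    by rewrite (min_idPl (le_trans (le_trans pp pq) qq)) subrr.
  have [qp'|pq] := leP (q k.+1) (p i).
    suff -> : m i k = 0 by rewrite !mulr0 normr0.
    rewrite /m (min_idPr qp') (min_idPr (le_trans qq qp')) (min_idPr (ltW qp)).
    by rewrite (min_idPr (le_trans qp' pp)) !subrr.
  have m0 : 0 <= m i k.
    rewrite /m (min_idPr (ltW qp)) (min_idPl (ltW pq)).
    have mm : Num.max (p i) (q k) <= Num.min (p i.+1) (q k.+1).
      by rewrite ge_max !le_min pp qq (ltW pq) (ltW qp).
    have h : f (Num.max (p i) (q k)) <= f (Num.min (p i.+1) (q k.+1)).
      apply: ndf => //; rewrite in_itv /=.
        by rewrite le_max h1 ge_max h2 h6.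
      by rewrite le_min h3 h7 ge_min h4.
    have := h; case: (leP (p i) (q k)) => _; lra.
  rewrite normrM (ger0_norm m0); apply: ler_wpM2r => //.
  by apply: hg; rewrite ?ltr_norml; lra.
have -> : \sum_(0 <= i < N) g (xi i) * (f (p i.+1) - f (p i)) =
    \sum_(0 <= i < N) \sum_(0 <= k < M) g (xi i) * m i k.
  by apply: eq_big_nat => i /andP[_ iN]; rewrite -row// mulr_sumr.
have -> : \sum_(0 <= k < M) g (tau k) * (f (q k.+1) - f (q k)) =
    \sum_(0 <= i < N) \sum_(0 <= k < M) g (tau k) * m i k.
  rewrite exchange_big /=.
  by apply: eq_big_nat => k /andP[_ kM]; rewrite -col// mulr_sumr.
have -> : e * (f b - f a) = \sum_(0 <= i < N) \sum_(0 <= k < M) e * m i k.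
  rewrite -pN -p0 -(@telescope_sumr _ 0 N (f \o p))// mulr_sumr.
  by apply: eq_big_nat => i /andP[_ iN]; rewrite -mulr_sumr row.
rewrite -sumrB; apply: (le_trans (ler_norm_sum _ _ _)).
rewrite big_nat [leRHS]big_nat; apply: ler_sum => i /andP[_ iN].
rewrite -sumrB; apply: (le_trans (ler_norm_sum _ _ _)).
rewrite big_nat [leRHS]big_nat; apply: ler_sum => k /andP[_ kM].
by rewrite -mulrBl term.
Qed.

Definition unif_point (R : realType) (a b : R) (n i : nat) : R :=
  a + (b - a) * (i%:R / n.+1%:R).

(** Left-tagged sums over [n.+1] equal cells. They turn the integral into the limit of a sequence,
    the form in which measurability can be read off. *)
Definition unif_sum (R : realType) (a b : R) (g f : R -> R) (n : nat) : R :=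
  \sum_(0 <= i < n.+1) g (unif_point a b n i) *
    (f (unif_point a b n i.+1) - f (unif_point a b n i)).

Lemma unif_point0 (R : realType) (a b : R) (n : nat) : unif_point a b n 0 = a.
Proof. by rewrite /unif_point mul0r mulr0 addr0. Qed.

Lemma unif_pointn (R : realType) (a b : R) (n : nat) :
  unif_point a b n n.+1 = b.
Proof. by rewrite /unif_point mulfV ?pnatr_eq0// mulr1 addrC subrK. Qed.

Lemma unif_pointS (R : realType) (a b : R) (n i : nat) :
  unif_point a b n i.+1 - unif_point a b n i = (b - a) / n.+1%:R.
Proof.
rewrite /unif_point opprD addrACA subrr add0r -mulrBr -mulrBl.
by rewrite -natr1 addrAC subrr add0r div1r.
Qed.

Lemma unif_point_itv (R : realType) (a b : R) (n i : nat) :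
  a <= b -> (i <= n.+1)%N -> a <= unif_point a b n i <= b.
Proof.
move=> ab ni; rewrite /unif_point lerDl mulr_ge0 ?subr_ge0 ?divr_ge0//=.
rewrite -lerBrDl ler_piMr ?subr_ge0//.
by rewrite ler_pdivrMr ?ltr0n// mul1r ler_nat.
Qed.

Lemma unif_point_le (R : realType) (a b : R) (n i : nat) :
  a <= b -> unif_point a b n i <= unif_point a b n i.+1.
Proof. by move=> ab; rewrite -subr_ge0 unif_pointS divr_ge0// subr_ge0. Qed.

Lemma unif_mesh_cvg (R : realType) (a b del : R) : 0 < del ->
  \forall n \near \oo, (b - a) / n.+1%:R < del.
Proof.
move=> del0.
have : (fun n => (b - a) * n.+1%:R^-1) @ \oo --> (b - a) * 0.
  by apply: cvgMr; exact: cvg_harmonic.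
rewrite mulr0 => /cvgr_lt; apply; exact: del0.
Qed.

Lemma is_RS_integral_unif_sum (R : realType) (a b I : R) (g f : R -> R) :
  a <= b -> is_RS_integral a b g f I -> unif_sum a b g f @ \oo --> I.
Proof.
move=> ab hI; apply/cvgrPdist_lt => e e0.
have [del del0 hdel] := hI e e0.
near=> n.
have mn : (b - a) / n.+1%:R < del by near: n; exact: unif_mesh_cvg.
have [ab'|ba] := ltP a b; last first.
  (* A partition is strictly increasing, so the degenerate segment has only the empty one; every
     term of the uniform sum is then 0. *)
  have {ba} Eab : a = b by apply/eqP; rewrite eq_le ab ba.
  have -> : unif_sum a b g f n = RS_sum a [::] (fun=> 0) g f.
    rewrite /unif_sum /RS_sum /= [RHS]big_geq// big1// => i _.
    by rewrite /unif_point Eab subrr !mul0r !addr0 subrr mulr0.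
  rewrite distrC; apply: hdel => //.
  by rewrite Eab.
pose s := mkseq (fun i => unif_point a b n i.+1) n.+1.
have ss : size s = n.+1 by rewrite size_mkseq.
have ns i : (i < n.+1)%N -> nth 0 s i = unif_point a b n i.+1.
  by move=> ?; rewrite nth_mkseq.
have nas i : (i < n.+2)%N -> nth 0 (a :: s) i = unif_point a b n i.
  by case: i => [|i] ?; rewrite /= ?unif_point0// ns.
have -> : unif_sum a b g f n = RS_sum a s (unif_point a b n) g f.
  rewrite /unif_sum /RS_sum ss; apply: eq_big_nat => i /andP[_ ni].
  by rewrite (ns i ni) (nas i (ltnW ni)).
rewrite distrC; apply: hdel.
  split; last by rewrite (last_nth 0) ss nas// unif_pointn.
  apply/(pathP 0) => i; rewrite ss => ni.
  rewrite (ns i ni) (nas i (ltnW ni)) -subr_gt0 unif_pointS divr_gt0//.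
  by rewrite subr_gt0.
move=> i; rewrite ss => ni.
rewrite (ns i ni) (nas i (ltnW ni)) unif_pointS; split => //.
by rewrite lexx unif_point_le.
Unshelve. all: by end_near. Qed.

Lemma RS_integral_unif_sum (R : realType) (a b : R) (g f : R -> R) :
  a <= b -> (exists I, is_RS_integral a b g f I) ->
  unif_sum a b g f @ \oo --> RS_integral a b g f.
Proof.
move=> ab [I hI]; apply: is_RS_integral_unif_sum => //.
by rewrite /RS_integral; case: xgetP => // /(_ I).
Qed.

Lemma is_RS_integralB (R : realType) (a b I J : R) (g f h : R -> R) :
  is_RS_integral a b g f I -> is_RS_integral a b g h J ->
  is_RS_integral a b g (f \- h) (I - J).
Proof.
move=> hI hJ e e0; have e2 : 0 < e / 2 by rewrite divr_gt0.
have [d1 d10 h1] := hI _ e2; have [d2 d20 h2] := hJ _ e2.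
exists (Num.min d1 d2); first by rewrite lt_min d10.
move=> s xi ps hs.
have -> : RS_sum a s xi g (f \- h) = RS_sum a s xi g f - RS_sum a s xi g h.
  by rewrite /RS_sum -sumrB; apply: eq_bigr => i _; rewrite /=; ring.
have -> : forall x y : R, x - y - (I - J) = (x - I) - (y - J) by move=> *; ring.
rewrite (le_lt_trans (ler_normB _ _))// [ltRHS]splitr ltrD//.
  by apply: h1 => // i /hs [+ ?]; rewrite lt_min => /andP[].
by apply: h2 => // i /hs [+ ?]; rewrite lt_min => /andP[].
Qed.

Lemma itv_partition_nth (R : realType) (a b : R) (s : seq R) (i : nat) :
  itv_partition a b s -> (i <= size s)%N -> a <= nth 0 (a :: s) i <= b.
Proof.
move=> ps ni; rewrite (set_nth_default b)//.
by rewrite itv_partition_nth_ge// itv_partition_nth_le.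
Qed.

(** Partition points and tags stay in [[a, b]]. This permits replacing an integrator by its Jordan
    decomposition, which is valid only there. *)
Lemma eq_is_RS_integral (R : realType) (a b I : R) (g g' f f' : R -> R) :
  (forall x, a <= x <= b -> g x = g' x) ->
  (forall x, a <= x <= b -> f x = f' x) ->
  is_RS_integral a b g f I -> is_RS_integral a b g' f' I.
Proof.
move=> eg ef hI e e0; have [del del0 hdel] := hI e e0.
exists del => // s xi ps hs.
suff <- : RS_sum a s xi g f = RS_sum a s xi g' f' by exact: hdel.
apply: eq_big_nat => i /andP[_ ni].
have h1 := itv_partition_nth ps (ltnW ni); have h2 := itv_partition_nth ps ni.
have [_ /andP[h3 h4]] := hs i ni.
rewrite eg ?ef//.
by rewrite (le_trans _ h3) ?(le_trans h4)//; case/andP: h1; case/andP: h2.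
Qed.

(** By [riemann_sum_compare] the uniform sums are Cauchy. The same comparison, between an arbitrary
    fine tagged partition and ever finer uniform ones, shows that their limit is the integral. *)
Lemma nondecreasing_RS_integrable (R : realType) (a b : R) (g f : R -> R) :
  a <= b -> {within `[a, b], continuous g} -> {in `[a, b] &, nondecreasing f} ->
  exists I, is_RS_integral a b g f I.
Proof.
move=> ab cg ndf.
pose V := f b - f a.
have V0 : 0 <= V.
  by rewrite subr_ge0; apply: ndf => //; rewrite in_itv /= lexx ab.
(* The denominator [V + 1] stays positive when [f] is constant, and keeps the resulting bound
   [e / (V + 1) * V] strictly below [e]. *)
have modulus (e : R) : 0 < e -> exists2 del : R, 0 < del &
    forall x y, a <= x <= b -> a <= y <= b -> `|x - y| < del + del ->
      `|g x - g y| <= e / (V + 1).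
  move=> e0; have := segment_unif_continuous cg (e := e / (V + 1)).
  case=> [|del del0 hdel]; first by rewrite divr_gt0// ltr_wpDl.
  exists (del / 2); first by rewrite divr_gt0.
  by move=> x y xab yab; rewrite -splitr => xy; exact/ltW/hdel.
have small (e : R) : 0 < e -> e / (V + 1) * V < e.
  move=> e0; rewrite mulrAC ltr_pdivrMr ?ltr_wpDl// ltr_pM2l//.
  by rewrite ltrDl.
have unif n del : (b - a) / n.+1%:R < del -> forall i, (i < n.+1)%N ->
    unif_point a b n i <= unif_point a b n i <= unif_point a b n i.+1 /\
    unif_point a b n i.+1 - unif_point a b n i < del.
  by move=> mn i ni; rewrite unif_pointS lexx unif_point_le.
have cS : cvgn (unif_sum a b g f).
  apply/cauchy_cvgP; apply: cauchy_exP => e e0.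
  have [del del0 hdel] := modulus e e0.
  have [N _ hN] := unif_mesh_cvg a b del0.
  exists (unif_sum a b g f N).
  suff : \forall n \near \oo, ball (unif_sum a b g f N) e (unif_sum a b g f n).
    by [].
  near=> n.
  rewrite /ball /=; apply: le_lt_trans (small _ e0).
  apply: (@riemann_sum_compare _ f g a b N.+1 n.+1 (unif_point a b N)
     (unif_point a b n) (unif_point a b N) (unif_point a b n) _ del) => //.
  - exact: unif_point0.
  - exact: unif_pointn.
  - by move=> i ni; exact: unif_point_itv.
  - by apply: unif; apply: hN => /=.
  - exact: unif_point0.
  - exact: unif_pointn.
  - by move=> i ni; exact: unif_point_itv.
  - by apply: unif; apply: hN; near: n; exists N.
exists (limn (unif_sum a b g f)) => e e0.
have e2 : 0 < e / 2 by rewrite divr_gt0.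
have [del del0 hdel] := modulus _ e2.
exists del => // s xi ps hs.
apply: (@le_lt_trans _ _ (e / 2 / (V + 1) * V)); last first.
  apply: lt_trans (small _ e2) _.
  by rewrite ltr_pdivrMr// mulr_natr mulr2n ltrDl.
have : (fun n => `|RS_sum a s xi g f - unif_sum a b g f n|) @ \oo -->
    `|RS_sum a s xi g f - limn (unif_sum a b g f)|.
  by apply: cvg_norm; apply: cvgB => //; exact: cvg_cst.
move/cvg_lim => <- //.
apply: limr_le.
  by apply: is_cvg_norm; apply: is_cvgB => //; exact: is_cvg_cst.
have [N _ hN] := unif_mesh_cvg a b del0.
near=> n.
apply: (@riemann_sum_compare _ f g a b (size s) n.+1 (nth 0 (a :: s))
   (unif_point a b n) xi _ _ del) => //.
- by have := itv_partition_nth_size 0 ps.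
- by move=> i ni; exact: itv_partition_nth.
- by move=> i ni; have [? ?] := hs i ni.
- exact: unif_point0.
- exact: unif_pointn.
- by move=> i ni; exact: unif_point_itv.
- by apply: unif; apply: hN; near: n; exists N.
Unshelve. all: by end_near. Qed.

(** Jordan decomposition into the positive and negative variations, both nondecreasing. *)
Lemma bounded_variation_RS_integrable (R : realType) (a b : R) (g f : R -> R) :
  a <= b -> {within `[a, b], continuous g} -> bounded_variation a b f ->
  exists I, is_RS_integral a b g f I.
Proof.
move=> ab cg bf.
have [I hI] := nondecreasing_RS_integrable ab cg
  (fine_neg_tv_nondecreasing (bounded_variationN bf)).
have [J hJ] := nondecreasing_RS_integrable ab cg (fine_neg_tv_nondecreasing bf).
exists (I - J); apply: eq_is_RS_integral (is_RS_integralB hI hJ) => // x xab.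
by rewrite [RHS](bounded_variation_pos_neg_tvE bf)// in_itv.
Qed.

(** The decrements over any partition lie in [K] and telescope to [f 0 - f t], so [cone_variation]
    bounds every variation sum by one constant. *)
Lemma cone_decreasing_bounded_variation (R : realType) (d : nat) (T t : R)
    (K : set 'rV[R]_d) (f : R -> 'rV[R]_d) (j : 'I_d) :
  closed K -> convex_cone K -> proper_cone K -> t <= T ->
  cone_decreasing T K f -> bounded_variation 0 t (fun s => f s ord0 j).
Proof.
move=> clK cK pK tT df.
have [C C0 hC] := cone_normal clK cK pK.
exists (2 * C * `|f 0 - f t|) => _ [s ps <-].
pose F i := f (nth t (0 :: s) i).
have KF i : (i < size s)%N -> K (F i - F i.+1).
  move=> si; rewrite -opprB.
  apply: (df (nth t (0 :: s) i) (nth t (0 :: s) i.+1)).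
  - by apply: itv_partition_nth_ge ps; rewrite ltnS ltnW.
  - by have [sp _] := ps; move/(pathP t): sp => /(_ i si)/ltW.
  - by apply: (le_trans (itv_partition_nth_le _ ps)).
have := cone_variation j cK pK hC KF.
rewrite -[X in `|X|]opprK -sumrN.
under [in X in - X]eq_bigr do rewrite opprB.
rewrite telescope_sumr// opprB /F /= (itv_partition_nth_size t ps) => h.
rewrite /variation; apply: le_trans h.
by apply: ler_sum => i _; rewrite !mxE distrC.
Qed.

(** * Measurability of the wealth *)

Lemma measurable_entry (R : realType) (d : nat) (j : 'I_d) :
  measurable_fun setT (fun v : borel_rV R d => (v : 'rV[R]_d) ord0 j).
Proof.
apply: (measurability _ (RGenOInfty.measurableE R)) => _ [_ [x ->] <-].
rewrite setTI; apply: sub_sigma_algebra => /=.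
apply: (@open_comp _ _ (fun v : 'rV[R]_d => v ord0 j) `]x, +oo[%classic).
  by move=> v _; exact: coord_continuous.
exact: interval_open.
Qed.

(** An open set is a countable union of boxes with rational centres, and the preimage of a box is a
    finite intersection of conditions on single entries. *)
Lemma measurable_rV (R : realType) (d : nat) (dd : measure_display)
    (X : measurableType dd) (f : X -> borel_rV R d) :
  (forall j, measurable_fun setT (fun x => (f x : 'rV[R]_d) ord0 j)) ->
  measurable_fun setT f.
Proof.
move=> mf.
apply: (@measurability _ _ X (borel_rV R d) setT f (@open 'rV[R]_d)) => //.
move=> _ [U oU <-]; rewrite setTI.
pose box (c : 'rV[rat]_d * nat) := [set v : 'rV[R]_d |
  forall j, `|ratr (c.1 ord0 j) - v ord0 j| < c.2.+1%:R^-1].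
have mbox c : measurable (f @^-1` box c).
  have -> : f @^-1` box c = \bigcap_(j in [set: 'I_d])
      [set x | `|ratr (c.1 ord0 j) - (f x : 'rV[R]_d) ord0 j| < c.2.+1%:R^-1].
    by apply/seteqP; split => x /= h j; [move=> _|]; exact: h.
  apply: fin_bigcap_measurable => [|j _]; first exact: finite_finset.
  have mg : measurable_fun setT
      (fun x => `|ratr (c.1 ord0 j) - (f x : 'rV[R]_d) ord0 j|).
    by apply: measurableT_comp => //; exact: measurable_funB.
  have mc : measurable_fun setT (fun _ : X => c.2.+1%:R^-1 : R).
    exact: measurable_cst.
  have := measurable_fun_ltr mg mc measurableT.
  by move=> /(_ [set true]); rewrite setTI; exact.
(* The union runs over the codes of boxes; codes of no box, or of a box not inside [U], contribute
   the empty set. *)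
have -> : f @^-1` U = \bigcup_k (if unpickle k is Some c then
    if `[< box c `<=` U >] then f @^-1` box c else set0 else set0).
  apply/seteqP; split => x /=; last first.
    move=> [k _]; case: unpickle => [c|//].
    by case: ifPn => // /asboolP h /h.
  move=> Ufx.
  have /nbhs_ballP [r /= r0 hr] : nbhs (f x : 'rV[R]_d) U.
    exact: open_nbhs_nbhs.
  have [n nr] : exists n, n.+1%:R^-1 < r / 2.
    have r2 : 0 < r / 2 by rewrite divr_gt0.
    have [n _ hn] := cvgr_lt _ (@cvg_harmonic R) _ r2.
    by exists n; apply: hn => /=.
  have n0 : 0 < n.+1%:R^-1 :> R by rewrite invr_gt0.
  have dense_rat (y h : R) : 0 < h -> exists q : rat, `|ratr q - y| < h.
    move=> h0; have [|q] := @rat_in_itvoo R (y - h) (y + h); first lra.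
    by rewrite in_itv /= => /andP[? ?]; exists q; rewrite ltr_norml; lra.
  have hq j := dense_rat ((f x : 'rV[R]_d) ord0 j) _ n0.
  pose q : 'rV[rat]_d := \row_j sval (cid (hq j)).
  have qE j : q ord0 j = sval (cid (hq j)) by rewrite mxE.
  exists (pickle (q, n)) => //; rewrite pickleK.
  rewrite ifT; first by move=> j /=; rewrite qE; case: cid.
  apply/asboolP => v bv; apply: hr; split => // i j.
  rewrite (ord1 i).
  have := bv j; rewrite /= qE; case: cid => q' /= h1 h2.
  rewrite /ball /= -(subrK (ratr q') ((f x : 'rV[R]_d) ord0 j)) -addrA.
  rewrite (le_lt_trans (ler_normD _ _))// [ltRHS]splitr ltrD//.
    by rewrite distrC; exact: lt_trans nr.
  exact: lt_trans nr.
by apply: bigcup_measurable => k _; case: unpickle => // c; case: ifP.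
Qed.

Lemma measurable_eval (R : realType) (n : nat) (T t : R) : 0 <= t <= T ->
  measurable_fun setT (fun f : path_space n T => f t : borel_rV R n).
Proof.
move=> tT _ A mA; rewrite setTI; apply: sub_sigma_algebra.
by exists t, A.
Qed.

Lemma measurable_path (R : realType) (n : nat) (T : R) (dd : measure_display)
    (X : measurableType dd) (f : X -> path_space n T) :
  (forall t, 0 <= t <= T ->
    measurable_fun setT (fun x => f x t : borel_rV R n)) ->
  measurable_fun setT f.
Proof.
move=> mf.
apply: (@measurability _ _ X (path_space n T) setT f (@cylinders R n T)) => //.
by move=> _ [_ [t [A [tT bA ->]]] <-]; exact: mf.
Qed.

Lemma measurable_path_entry (R : realType) (n : nat) (T t : R)
    (dd : measure_display) (X : measurableType dd) (f : X -> path_space n T)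
    (j : 'I_n) : 0 <= t <= T -> measurable_fun setT f ->
  measurable_fun setT (fun x => (f x t : 'rV[R]_n) ord0 j).
Proof.
move=> tT mf; have := measurableT_comp (measurable_eval (n := n) tT) mf.
by move/(measurableT_comp (measurable_entry (R := R) j)).
Qed.

(** The inverse is discontinuous only at 0, a single point that is treated separately. *)
Lemma measurable_invr (R : realType) : measurable_fun setT (@GRing.inv R).
Proof.
rewrite -(setUv [set 0]).
have mC : measurable (~` [set (0 : R)]) by exact: measurableC.
apply/measurable_funU => //; split; first exact: measurable_fun_set1.
apply: open_continuous_measurable_fun.
  by rewrite openC; exact: closed_eq.
by move=> x; rewrite inE /= => /eqP x0; exact: inv_continuous.
Qed.

(** A total substitute for the limit that stays measurable in parameters; [fine] sends infinite
    values to 0. *)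
Definition real_limsup (R : realType) (u : nat -> R) : R :=
  fine (limn_esup (fun n => (u n)%:E)).

Lemma real_limsupE (R : realType) (u : nat -> R) (l : R) :
  u @ \oo --> l -> real_limsup u = l.
Proof.
move=> ul.
have ul' : (fun n => (u n)%:E) @ \oo --> l%:E.
  by apply: cvg_EFin => //; exact: nearW.
rewrite /real_limsup is_cvg_limn_esupE; last by apply/cvg_ex; exists l%:E.
by rewrite (cvg_lim _ ul').
Qed.

Lemma measurable_real_limsup (R : realType) (dd : measure_display)
    (X : measurableType dd) (f : nat -> X -> R) :
  (forall n, measurable_fun setT (f n)) ->
  measurable_fun setT (fun x => real_limsup (f^~ x)).
Proof.
move=> mf; apply: measurableT_comp; first exact: fine_measurable.
apply: (measurable_fun_limn_esup (f := fun n x => (f n x)%:E)) => n.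
exact/measurable_EFinP.
Qed.

(** The wealth as a functional of two deterministic paths, free of any model, so that it can be
    compared across models. *)
Definition path_wealth (R : realType) (d : nat) (x : 'rV[R]_d)
    (s b : R -> 'rV[R]_d) (t : R) : 'rV[R]_d :=
  \row_j (s t ord0 j * (x ord0 j +
    RS_integral0 t (fun r => (s r ord0 j)^-1) (fun r => b r ord0 j))).

Lemma wealthE (R : realType) (p d : nat) (T : R) (M : market_model p d T)
    (x : 'rV[R]_d) (B : Omega M -> R -> 'rV[R]_d) (w : Omega M) (t : R) :
  wealth x B w t = path_wealth x (price w) (B w) t.
Proof. by apply/rowP => j; rewrite !mxE. Qed.

(* On an arbitrary pair of paths the limit of Riemann sums that defines the
   wealth need not exist; the limsup extends it measurably. *)
Definition wealth_limsup (R : realType) (d : nat) (x : 'rV[R]_d)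
    (s b : R -> 'rV[R]_d) (t : R) : 'rV[R]_d :=
  \row_j (s t ord0 j * (x ord0 j + ((s 0 ord0 j)^-1 * b 0 ord0 j +
    real_limsup (unif_sum 0 t (fun r => (s r ord0 j)^-1)
                              (fun r => b r ord0 j))))).

Lemma measurable_wealth_limsup (R : realType) (d : nat) (T : R) (x : 'rV[R]_d)
    (t : R) (dd : measure_display) (X : measurableType dd)
    (s b : X -> path_space d T) :
  0 <= t <= T -> measurable_fun setT s -> measurable_fun setT b ->
  measurable_fun setT (fun w => wealth_limsup x (s w) (b w) t : borel_rV R d).
Proof.
move=> tT ms mb; have /andP[t0 t1] := tT.
have m1 (j : 'I_d) (r : R) : 0 <= r <= T ->
    measurable_fun setT (fun w => (s w r : 'rV[R]_d) ord0 j).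
  by move=> rT; exact: measurable_path_entry.
have m2 (j : 'I_d) (r : R) : 0 <= r <= T ->
    measurable_fun setT (fun w => (b w r : 'rV[R]_d) ord0 j).
  by move=> rT; exact: measurable_path_entry.
have T0 : 0 <= (0 : R) <= T by rewrite lexx (le_trans t0).
have mV (j : 'I_d) (r : R) : 0 <= r <= T ->
    measurable_fun setT (fun w => ((s w r : 'rV[R]_d) ord0 j)^-1).
  by move=> rT; exact: (measurableT_comp (@measurable_invr R) (m1 j r rT)).
apply: measurable_rV => j; rewrite /wealth_limsup.
under eq_fun do rewrite mxE.
apply: measurable_funM; first exact: m1.
apply: measurable_funD => //; apply: measurable_funD.
  by apply: measurable_funM; [exact: mV|exact: m2].
apply: measurable_real_limsup => n; rewrite /unif_sum.
under eq_fun do rewrite big_mkord.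
have uT i : (i <= n.+1)%N -> 0 <= unif_point 0 t n i <= T.
  by move=> ni; have /andP[-> /= /le_trans->] := unif_point_itv t0 ni.
apply: measurable_sum => i; apply: measurable_funM.
  by apply: mV; apply: uT; exact: ltnW.
apply: measurable_funB; apply: m2; apply: uT => //; exact: ltnW.
Qed.

(** A positive continuous price has a continuous inverse, and a [K]-decreasing path has entries of
    bounded variation. The integral therefore exists and the uniform sums converge to it. *)
Lemma path_wealthE (R : realType) (d : nat) (T : R) (K : set 'rV[R]_d)
    (x : 'rV[R]_d) (s b : R -> 'rV[R]_d) (t : R) :
  closed K -> convex_cone K -> proper_cone K ->
  0 <= t <= T -> {within `[0, T], continuous s} ->
  (forall (r : R) j, 0 <= r <= T -> 0 < s r ord0 j) -> cone_decreasing T K b ->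
  path_wealth x s b t = wealth_limsup x s b t.
Proof.
move=> clK cK pK /andP[t0 tT] cs s0 db; apply/rowP => j; rewrite !mxE /=.
congr (_ * (_ + (_ + _))); apply/esym/real_limsupE.
apply: RS_integral_unif_sum => //.
apply: bounded_variation_RS_integrable => //; last first.
  exact: cone_decreasing_bounded_variation db.
apply/subspace_continuousP => r /=; rewrite in_itv /= => /andP[r0 rt].
have rT : r <= T by exact: le_trans tT.
apply: cvgV; first by rewrite gt_eqF// s0// r0.
have sr : s y @[y --> within `[0, t] (nbhs r)] --> s r.
  have : {within `[0, t], continuous s}.
    apply: continuous_subspaceW cs => y /=; rewrite !in_itv /= => /andP[-> /=].
    by move=> /le_trans; apply.
  by move/subspace_continuousP; apply; rewrite /= in_itv /= r0.
apply: (@cvg_comp _ _ _ s (fun v : 'rV[R]_d => v ord0 j) _ _ _ sr).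
exact: (@coord_continuous R 1 d ord0 j (s r)).
Qed.

(** * Right-continuous regularization along the dyadic times *)

Lemma cvg_rV (R : realType) (d : nat) (I : Type) (F : set_system I)
    (FF : Filter F) (f : I -> 'rV[R]_d) (l : 'rV[R]_d) :
  (forall j, (fun i => f i ord0 j) @ F --> l ord0 j) -> f @ F --> l.
Proof.
move=> h; apply/cvg_ballP => e e0.
have : \forall i \near F, forall j : 'I_d, ball (l ord0 j) e (f i ord0 j).
  by apply: filter_forall => j; have /cvg_ballP := h j; apply.
apply: filterS => i hi; split => // a j; rewrite (ord1 a); exact: hi.
Qed.

Lemma cone_monotone_cvg_rV (R : realType) (d : nat) (K : set 'rV[R]_d)
    (v : nat -> 'rV[R]_d) (a : 'rV[R]_d) :
  closed K -> convex_cone K -> proper_cone K ->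
  (forall n, K (v n - v n.+1)) -> (forall n, K (v n - a)) ->
  cvgn v.
Proof.
move=> clK cK pK dv va; apply/cvg_ex.
exists (\row_j limn (fun n => v n ord0 j)); apply: cvg_rV => j; rewrite mxE.
exact: cone_monotone_cvg dv va.
Qed.

(* By normality |f i - l| <= C |v n - l|, as v n - l splits into two cone
   elements one of which is f i - l (or all signs are reversed). *)
Lemma cone_sandwich_cvg (R : realType) (d : nat) (K : set 'rV[R]_d) (I : Type)
    (F : set_system I) (FF : Filter F) (f : I -> 'rV[R]_d) (v : nat -> 'rV[R]_d)
    (l : 'rV[R]_d) :
  closed K -> convex_cone K -> proper_cone K -> v @ \oo --> l ->
  (forall n, \forall i \near F, (K (f i - l) /\ K (v n - f i)) \/
     (K (l - f i) /\ K (f i - v n))) -> f @ F --> l.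
Proof.
move=> clK cK pK vl hf; have [C C0 hC] := cone_normal clK cK pK.
apply/cvgrPdist_lt => e e0.
have eC : 0 < e / C by rewrite divr_gt0.
have [N _ hN] := cvgr_dist_lt _ _ vl _ eC.
have {hN} vN : `|l - v N| < e / C by apply: hN => /=.
have := hf N; apply: filterS => i [] [h1 h2].
  have -> : l - f i = - (f i - l) by rewrite opprB.
  have := hC _ _ h1 h2; rewrite [_ + (v N - _)]addrC addrA subrK normrN.
  move=> /le_lt_trans; apply.
  by rewrite distrC mulrC -ltr_pdivlMr.
have := hC _ _ h1 h2; rewrite addrA subrK => /le_lt_trans; apply.
by rewrite mulrC -ltr_pdivlMr.
Qed.

(** The limit exists along one sequence increasing to [t], where [f t] is a lower bound in the cone
    order; monotonicity extends it to all [u] tending to [t] from the left. *)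
Lemma cone_decreasing_left_lim (R : realType) (d : nat) (T t : R)
    (K : set 'rV[R]_d) (f : R -> 'rV[R]_d) :
  closed K -> convex_cone K -> proper_cone K ->
  cone_decreasing T K f -> 0 < t <= T -> cvg (f @ t^'-).
Proof.
move=> clK cK pK df /andP[t0 tT].
have {}df s u : 0 <= s -> s <= u -> u <= T -> K (f s - f u).
  by move=> s0 su uT; rewrite -opprB; exact: df.
pose s n : R := t * (1 - n.+1%:R^-1).
have sS n : s n <= s n.+1.
  rewrite /s ler_pM2l// lerB// lef_pV2 ?posrE ?ltr0n// ler_nat.
  by rewrite ltnW.
have st n : s n < t by rewrite /s gtr_pMr// gtrBl invr_gt0.
have s0 n : 0 <= s n.
  by rewrite /s mulr_ge0 ?(ltW t0)// subr_ge0 invf_le1// ler1n.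
have scvg : s @ \oo --> t.
  rewrite -[X in _ --> X]mulr1 -[X in _ --> t * X]subr0.
  apply: cvgMr; apply: cvgB; first exact: cvg_cst.
  exact: cvg_harmonic.
have sT n : s n <= T by rewrite (le_trans (ltW (st n))).
have cv : cvgn (f \o s).
  apply: (@cone_monotone_cvg_rV _ _ K _ (f t)) => // n /=.
    by apply: df => //.
  by apply: df => //; exact: ltW.
apply/cvg_ex; exists (limn (f \o s)).
apply: (@cone_sandwich_cvg _ _ K _ _ _ f (f \o s)) => // n.
have tn : \forall u \near t^'-, s n < u by exact: nbhs_left_gt.
have tt : \forall u \near t^'-, u < t by exact: nbhs_left_lt.
apply: filterS2 tn tt => u su ut; left; split => /=; last first.
  by apply: df; [|exact: ltW|rewrite (le_trans (ltW ut))].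
(* Eventually [s m] passes [u], so [f u - f (s m)] lies in [K], and closedness keeps this in the
   limit. *)
apply: (@closed_cvg _ _ \oo _ (fun m => f u - (f \o s) m) K) => //; last first.
  by apply: cvgB => //; exact: cvg_cst.
near=> m; have um : u < s m by near: m; exact: (cvgr_gt _ scvg _ ut).
by apply: df => //; [rewrite (le_trans (s0 n))// ltW|exact: ltW].
Unshelve. all: by end_near. Qed.

Definition dyadic (R : realType) (T : R) (n k : nat) : R :=
  Num.min T (T * (k%:R / 2 ^+ n)).

(** Truncation plus one makes the grid point strictly later than [t] when [t < T]; the cap in
    [dyadic] makes it equal to [T] at [t = T]. *)
Definition next_dyadic (R : realType) (T : R) (n : nat) (t : R) : R :=
  dyadic T n (Num.truncn (2 ^+ n * (t / T))).+1.

Lemma dyadic_itv (R : realType) (T : R) (n k : nat) :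
  0 < T -> 0 <= dyadic T n k <= T.
Proof.
move=> T0; rewrite /dyadic ge_min lexx /= andbT le_min (ltW T0) /=.
by rewrite mulr_ge0 ?(ltW T0)// divr_ge0// exprn_ge0.
Qed.

Lemma next_dyadic_end (R : realType) (T : R) (n : nat) :
  0 < T -> next_dyadic T n T = T.
Proof.
move=> T0; apply/min_idPl; rewrite ler_peMr ?(ltW T0)//.
rewrite mulfV ?gt_eqF// mulr1 ler_pdivlMr ?exprn_gt0// mul1r.
by have /andP[_ /ltW] := truncn_itv (exprn_ge0 n (ler0n R 2)).
Qed.

Lemma next_dyadic_gt (R : realType) (T t : R) (n : nat) :
  0 < T -> 0 <= t < T -> t < next_dyadic T n t.
Proof.
move=> T0 /andP[t0 tT]; rewrite /next_dyadic /dyadic lt_min tT /=.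
have /truncn_itv/andP[_] : 0 <= 2 ^+ n * (t / T).
  by rewrite mulr_ge0 ?exprn_ge0// divr_ge0// ltW.
rewrite -ltr_pdivrMl// ltr_pdivlMr ?exprn_gt0//.
by rewrite [T^-1 * t]mulrC [_ / _ * _]mulrC.
Qed.

Lemma next_dyadic_ge (R : realType) (T t : R) (n : nat) :
  0 < T -> 0 <= t <= T -> t <= next_dyadic T n t.
Proof.
move=> T0 /andP[t0]; rewrite le_eqVlt => /predU1P[->|tT].
  by rewrite next_dyadic_end.
by apply/ltW/next_dyadic_gt => //; rewrite t0.
Qed.

Lemma next_dyadic_le (R : realType) (T s t : R) (n : nat) :
  0 < T -> s <= t -> next_dyadic T n s <= next_dyadic T n t.
Proof.
move=> T0 st; rewrite /next_dyadic /dyadic le_min ge_min lexx /= ge_min.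
apply/orP; right; rewrite ler_pM2l// ler_pM2r ?invr_gt0 ?exprn_gt0//.
rewrite ler_nat ltnS; apply: le_truncn.
by rewrite ler_pM2l ?exprn_gt0// ler_pM2r ?invr_gt0.
Qed.

Lemma next_dyadicS (R : realType) (T t : R) (n : nat) :
  0 < T -> 0 <= t -> next_dyadic T n.+1 t <= next_dyadic T n t.
Proof.
move=> T0 t0; rewrite /next_dyadic /dyadic le_min ge_min lexx /= ge_min.
apply/orP; right; rewrite ler_pM2l//.
have x0 : 0 <= 2 ^+ n * (t / T).
  by rewrite mulr_ge0 ?exprn_ge0// divr_ge0// ltW.
have y0 : 0 <= 2 * (2 ^+ n * (t / T)) by rewrite mulr_ge0.
rewrite exprS -[2 * _ * _]mulrA.
have /andP[h1 _] := truncn_itv y0; have /andP[_ h2] := truncn_itv x0.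
set k := Num.truncn (2 ^+ n * (t / T)) in h2 *.
set l := Num.truncn (2 * (2 ^+ n * (t / T))) in h1 *.
(* The grids are nested: with [x = 2 ^+ n * (t / T)], one has [l <= 2 * x < 2 * k.+1], a strict
   inequality between integers. *)
have lk : (l.+1 <= 2 * k.+1)%N.
  rewrite -(ltr_nat R) natrM (le_lt_trans h1)// ltr_pM2l//.
rewrite invfM mulrA ler_pM2r ?invr_gt0 ?exprn_gt0//.
by rewrite ler_pdivrMr// -natrM ler_nat mulnC.
Qed.

Lemma next_dyadic_cvg (R : realType) (T t : R) : 0 < T -> 0 <= t <= T ->
  (fun n => next_dyadic T n t) @ \oo --> t.
Proof.
move=> T0 tT; have /andP[t0 _] := tT; apply/cvgrPdist_lt => e e0.
have eT : 0 < e / T by rewrite divr_gt0.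
have := near_infty_natSinv_expn_lt (PosNum eT); apply: filterS => n /= ne.
rewrite distrC ger0_norm ?subr_ge0; last exact: next_dyadic_ge.
have x0 : 0 <= 2 ^+ n * (t / T).
  by rewrite mulr_ge0 ?exprn_ge0// divr_ge0// ltW.
have /andP[h1 _] := truncn_itv x0.
apply: (@le_lt_trans _ _ (T * ((2 ^+ n * (t / T) + 1) / 2 ^+ n) - t)).
  rewrite lerB// /next_dyadic /dyadic ge_min; apply/orP; right.
  by rewrite ler_pM2l// ler_pM2r ?invr_gt0 ?exprn_gt0// -natr1 lerD2r.
have -> : T * ((2 ^+ n * (t / T) + 1) / 2 ^+ n) - t = T * (1 / 2 ^+ n).
  by field; rewrite gt_eqF//= gt_eqF// exprn_gt0.
by rewrite mulrC -ltr_pdivlMr.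
Qed.

(** Intended as the right limit along dyadic times; the entrywise upper limit makes it total and
    measurable in [beta]. *)
Definition regularize (R : realType) (d : nat) (T : R) (beta : R -> 'rV[R]_d)
    (t : R) : 'rV[R]_d :=
  \row_j real_limsup (fun n => beta (next_dyadic T n t) ord0 j).

(** Monotonicity tested on countably many pairs of times, so that it cuts out a measurable set of
    parameters. *)
Definition dyadic_decreasing (R : realType) (d : nat) (T : R)
    (K : set 'rV[R]_d) (beta : R -> 'rV[R]_d) : Prop :=
  forall n k m l, dyadic T n k <= dyadic T m l ->
    K (beta (dyadic T n k) - beta (dyadic T m l)).

Lemma regularize_cvg (R : realType) (d : nat) (T t : R)
    (K : set 'rV[R]_d) (beta : R -> 'rV[R]_d) :
  closed K -> convex_cone K -> proper_cone K -> 0 < T ->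
  dyadic_decreasing T K beta -> 0 <= t <= T ->
  (fun n => beta (next_dyadic T n t)) @ \oo --> regularize T beta t.
Proof.
move=> clK cK pK T0 db /andP[t0 tT].
have E0 : 0 = dyadic T 0 0 by rewrite /dyadic mul0r mulr0 min_r// ltW.
have cv : cvgn (fun n => beta (next_dyadic T n t)).
  (* The times [next_dyadic T n t] decrease in [n], so the values of [beta] increase; negation turns
     them into a decreasing sequence, bounded below by [- beta 0]. *)
  rewrite -is_cvgNE; apply: (@cone_monotone_cvg_rV _ _ K _ (- beta 0)) => // n.
    rewrite opprK addrC; exact: (db _ _ _ _ (next_dyadicS n T0 t0)).
  rewrite opprK addrC {1}E0; apply: db; rewrite -E0.
  by have /andP[] := dyadic_itv n (Num.truncn (2 ^+ n * (t / T))).+1 T0.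
have /cvg_ex [l hl] := cv.
suff -> : regularize T beta t = l by [].
apply/rowP => j; rewrite mxE; apply: real_limsupE.
apply: (@cvg_comp _ _ _ (fun n => beta (next_dyadic T n t))
  (fun v : 'rV[R]_d => v ord0 j) _ _ _ hl).
exact: (@coord_continuous R 1 d ord0 j l).
Qed.

Lemma regularize_decreasing (R : realType) (d : nat) (T : R)
    (K : set 'rV[R]_d) (beta : R -> 'rV[R]_d) :
  closed K -> convex_cone K -> proper_cone K -> 0 < T ->
  dyadic_decreasing T K beta -> cone_decreasing T K (regularize T beta).
Proof.
move=> clK cK pK T0 db s t s0 st tT /=; rewrite opprB.
have sT : 0 <= s <= T by rewrite s0 (le_trans st).
have tT' : 0 <= t <= T by rewrite tT (le_trans s0).
apply: (@closed_cvg _ _ \oo _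
    (fun n => beta (next_dyadic T n s) - beta (next_dyadic T n t)) K) => //.
  by apply: nearW => n; apply: db; exact: next_dyadic_le.
by apply: cvgB; exact: (regularize_cvg clK cK pK T0 db).
Qed.

Lemma regularize_ge (R : realType) (d : nat) (T t : R)
    (K : set 'rV[R]_d) (beta : R -> 'rV[R]_d) (n k : nat) :
  closed K -> convex_cone K -> proper_cone K -> 0 < T ->
  dyadic_decreasing T K beta -> 0 <= t -> t < dyadic T n k ->
  K (regularize T beta t - beta (dyadic T n k)).
Proof.
move=> clK cK pK T0 db t0 tk.
have tT : 0 <= t <= T.
  by rewrite t0 (le_trans (ltW tk))//; have /andP[] := dyadic_itv n k T0.
apply: (@closed_cvg _ _ \oo _
    (fun m => beta (next_dyadic T m t) - beta (dyadic T n k)) K) => //.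
  near=> m; apply: db; apply: ltW.
  by near: m; exact: (cvgr_lt _ (next_dyadic_cvg T0 tT) _ tk).
by apply: cvgB; [exact: (regularize_cvg clK cK pK T0 db)|exact: cvg_cst].
Unshelve. all: by end_near. Qed.

(** For [u] between [t] and [next_dyadic T n t], the value at [u] is caught between the value at [t]
    and [beta (next_dyadic T n t)], and the latter tends to the former. *)
Lemma regularize_rcll (R : realType) (d : nat) (T : R)
    (K : set 'rV[R]_d) (beta : R -> 'rV[R]_d) :
  closed K -> convex_cone K -> proper_cone K -> 0 < T ->
  dyadic_decreasing T K beta -> rcll T (regularize T beta).
Proof.
move=> clK cK pK T0 db.
have df := regularize_decreasing clK cK pK T0 db.
split=> t tT; last exact: (cone_decreasing_left_lim clK cK pK df tT).
have /andP[t0 ltT] := tT.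
have tT' : 0 <= t <= T by rewrite t0 ltW.
apply: (@cone_sandwich_cvg _ _ K _ _ _ _ _ _ clK cK pK
  (regularize_cvg clK cK pK T0 db tT')) => n.
have tn := next_dyadic_gt n T0 tT.
have h1 : \forall u \near t^'+, t < u by exact: nbhs_right_gt.
have h2 : \forall u \near t^'+, u < next_dyadic T n t by exact: nbhs_right_lt.
apply: filterS2 h1 h2 => u tu un; right; split.
  rewrite -opprB; apply: df => //; first exact: ltW.
  apply/ltW/(lt_le_trans un).
  by have /andP[] := dyadic_itv n (Num.truncn (2 ^+ n * (t / T))).+1 T0.
by apply: regularize_ge un => //; rewrite (le_trans t0)// ltW.
Qed.

Lemma regularize_id (R : realType) (d : nat) (T t : R)
    (f beta : R -> 'rV[R]_d) :
  0 < T -> rcll T f -> (forall n k, beta (dyadic T n k) = f (dyadic T n k)) ->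
  0 <= t <= T -> regularize T beta t = f t.
Proof.
move=> T0 [rf _] bf tT; have /andP[t0] := tT; rewrite le_eqVlt => tT'.
suff cf : (fun n => f (next_dyadic T n t)) @ \oo --> f t.
  apply/rowP => j; rewrite mxE; apply: real_limsupE.
  under eq_fun do rewrite bf.
  apply: (@cvg_comp _ _ _ (fun n => f (next_dyadic T n t))
    (fun v : 'rV[R]_d => v ord0 j) _ _ _ cf).
  exact: (@coord_continuous R 1 d ord0 j (f t)).
case/predU1P : tT' => [->|ltT].
  by under eq_fun do rewrite next_dyadic_end//; exact: cvg_cst.
have tT'' : 0 <= t < T by rewrite t0.
(* The filter [t^'+] excludes [t] itself, hence the need for grid points strictly later than [t]. *)
apply: (@cvg_comp _ _ _ (fun n => next_dyadic T n t) f _ _ _ _ (rf t tT'')).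
move=> A [e /= e0 hA].
near=> n; apply: hA; last exact: next_dyadic_gt.
by near: n; exact: (cvgr_dist_lt _ _ (next_dyadic_cvg T0 tT) _ e0).
Unshelve. all: by end_near. Qed.

(** * Strategies as functionals of the driving process *)

(** Generators of the raw canonical filtration on paths, before any null sets are added. *)
Definition cylinders_upto (R : realType) (n : nat) (t : R) :
    set_system (R -> 'rV[R]_n) :=
  [set C | exists (s : R) A,
    [/\ 0 <= s <= t, borel A & C = [set f | A (f s)]]].

Lemma filtration_measurable (R : realType) (p d : nat) (T t : R)
    (M : market_model p d T) (E : set (Omega M)) :
  0 <= t <= T -> filtration M t E -> measurable E.
Proof.
move=> tT; rewrite filtrationE// /filtration_of.
apply: smallest_sub; first exact: sigma_algebra_measurable.
move=> A [[s [B [/andP[s0 st] bB ->]]]|[]//].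
have /andP[_ h] := tT.
by apply: (driving_measurable M) => //; rewrite s0 (le_trans st).
Qed.

Lemma measurable_driving (R : realType) (p d : nat) (T : R)
    (M : market_model p d T) :
  measurable_fun setT (driving (m := M) : Omega M -> path_space p T).
Proof.
apply: measurable_path => t tT _ A mA; rewrite setTI.
exact: (driving_measurable M).
Qed.

Lemma measurable_adapted (R : realType) (p d n : nat) (T : R)
    (M : market_model p d T) (X : Omega M -> R -> 'rV[R]_n) :
  adapted T (filtration M) X ->
  measurable_fun setT (X : Omega M -> path_space n T).
Proof.
move=> aX; apply: measurable_path => t tT _ A mA; rewrite setTI.
by apply: (filtration_measurable tT); exact: aX.
Qed.

(** The sets with such a representation form a sigma-algebra that contains the generators; a null
    set is represented by the empty set. *)
Lemma filtration_factor (R : realType) (p d : nat) (T t : R)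
    (M : market_model p d T) (E : set (Omega M)) :
  0 <= t <= T -> filtration M t E ->
  exists2 C, <<s @cylinders_upto R p t >> C &
    {ae prob M, forall w, E w <-> C (driving w)}.
Proof.
move=> tT; rewrite filtrationE// /filtration_of.
apply: (@smallest_sub _ _ _ [set E : set (Omega M) |
    exists2 C, <<s @cylinders_upto R p t >> C &
    {ae prob M, forall w, E w <-> C (driving w)}]); last first.
  move=> A [[s [B [st bB ->]]]|[mA A0]].
    exists [set f | B (f s)]; last exact: aeW.
    by apply: sub_sigma_algebra; exists s, B.
  exists set0; first exact: sigma_algebra0.
  exists A; split => // w /= Aw; apply: contrapT => nA; apply: Aw.
  by split.
split.
- by exists set0; [exact: sigma_algebra0|exact: aeW].
- move=> A [C sC hC]; exists (~` C); first exact: sigma_algebraC.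
  apply: filterS hC => w AC; split => /=; first by move=> [_ nA] /AC.
  by move=> nC; split => // /AC.
- move=> F hF.
  have /choice [C hC] : forall n, exists C : set (R -> 'rV[R]_p),
      <<s @cylinders_upto R p t >> C /\
      {ae prob M, forall w, F n w <-> C (driving w)}.
    by move=> n; have [C] := hF n; exists C.
  exists (\bigcup_n C n).
    by apply: sigma_algebra_bigcup => n; have [] := hC n.
  have : {ae prob M, forall w n, F n w <-> C n (driving w)}.
    by apply/ae_foralln => n; have [] := hC n.
  apply: filterS => w h; split => -[n _ hn]; exists n => //; exact/h.
Qed.

Lemma cylinders_upto_measurable (R : realType) (p : nat) (T t : R)
    (C : set (path_space p T)) : t <= T ->
  <<s @cylinders_upto R p t >> C -> measurable C.
Proof.
move=> tT; apply: smallest_sub; first exact: sigma_algebra_measurable.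
move=> _ [s [A [/andP[s0 st] bA ->]]]; apply: sub_sigma_algebra.
by exists s, A; rewrite s0 (le_trans st).
Qed.

(** Converse of [filtration_factor]: off a null set [N] the event is a preimage under the driving
    path, and its part inside [N] is itself a null event of the filtration. *)
Lemma filtration_preimage (R : realType) (p d : nat) (T t : R)
    (M : market_model p d T) (C : set (R -> 'rV[R]_p)) (F : set (Omega M)) :
  0 <= t <= T -> <<s @cylinders_upto R p t >> C -> measurable F ->
  {ae prob M, forall w, F w <-> C (driving w)} -> filtration M t F.
Proof.
move=> tT sC mF [N [mN N0 FN]]; rewrite filtrationE//.
pose G := [set E : set (Omega M) | exists (s : R) A,
         [/\ 0 <= s <= t, borel A & E = [set w | A (driving w s)]]] `|`
      [set N | measurable N /\ prob M N = 0%E].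
have mG A : measurable A -> prob M A = 0%E ->
    measurable (A : set (g_sigma_algebraType G)).
  by move=> mA A0; apply: sub_sigma_algebra; right.
have mC : measurable ([set w | C (driving w)] : set (g_sigma_algebraType G)).
  move: sC; apply: (@smallest_sub _ _ _ [set C : set (R -> 'rV[R]_p) |
    measurable ([set w | C (driving w)] : set (g_sigma_algebraType G))]).
    split => [|A mA|A mA] /=.
    - exact: measurable0.
    - rewrite (_ : [set _ | _] = ~` [set w | A (driving w)]).
        exact: measurableC.
      by apply/seteqP; split => w /=; [case|split].
    - rewrite (_ : [set _ | _] = \bigcup_n [set w | A n (driving w)]).
        by apply: bigcup_measurable => n _; exact: mA.
      by apply/seteqP; split => w [n]; exists n.
  move=> _ [s [A [st bA ->]]]; apply: sub_sigma_algebra; left.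
  by exists s, A.
suff : measurable (F : set (g_sigma_algebraType G)) by [].
have -> : F = ([set w | C (driving w)] `\` N) `|` (F `&` N).
  apply/seteqP; split => w.
    move=> Fw; have [Nw|Nw] := pselect (N w); [by right|left; split => //].
    exact/(contra_notP (@FN w) Nw).
  by move=> [[Cw Nw]|[]//]; exact/(contra_notP (@FN w) Nw).
apply: measurableU; first by apply: measurableD => //; exact: mG.
apply: mG; first exact: measurableI.
by apply: (subset_measure0 _ _ _ N0) => //; exact: measurableI.
Qed.

(* beta is the supremum of the rationals r whose set C r contains the point. *)
Lemma ae_factor_real (R : realType) (d1 d2 : measure_display)
    (X : measurableType d1) (Z : measurableType d2)
    (P : {measure set X -> \bar R}) (Y : X -> Z) (f : X -> R) :
  (forall r : R, exists2 C : set Z, measurable C &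
    {ae P, forall w, r < f w <-> C (Y w)}) ->
  exists2 beta : Z -> R, measurable_fun setT beta &
    {ae P, forall w, beta (Y w) = f w}.
Proof.
move=> hf.
(* An enumeration of the rationals. The default 0 is harmless, as [C n] is chosen for the level
   [q n] whatever it is. *)
pose q n : R := if unpickle n is Some r then ratr r else 0.
have /choice [C hC] : forall n, exists C : set Z, measurable C /\
    {ae P, forall w, q n < f w <-> C (Y w)}.
  by move=> n; have [C] := hf (q n); exists C.
pose h n z : \bar R := if z \in C n then (q n)%:E else -oo%E.
have mh n : measurable_fun setT (h n).
  apply: measurable_fun_ifT => //.
  apply: (measurable_fun_bool true); rewrite setTI.
  rewrite (_ : _ @^-1` _ = C n); first by have [] := hC n.
  by apply/seteqP; split => z /= => [/set_mem|/mem_set].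
exists (fun z => fine (ereal_sup (range (h^~ z)))).
  apply: (measurableT_comp (fine_measurable measurableT)).
  have := measurable_fun_esups mh 0.
  congr measurable_fun; apply/funext => z; rewrite /esups /sdrop.
  congr ereal_sup; apply/seteqP; split => _ [n _ <-].
    by exists n.
  by exists n.
have : {ae P, forall w n, q n < f w <-> C n (Y w)}.
  by apply/ae_foralln => n; have [] := hC n.
apply: filterS => w hw.
suff -> : ereal_sup (range (h^~ (Y w))) = (f w)%:E by [].
apply/eqP; rewrite eq_le; apply/andP; split.
  apply: ge_ereal_sup => _ [n _ <-]; rewrite /h.
  case: ifPn => [|_]; last exact: leNye.
  by rewrite inE => /hw /ltW; rewrite lee_fin.
(* A rational level between [f w - e] and [f w] belongs to the supremum. *)
apply/lee_subgt0Pr => e e0.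
have [|r] := @rat_in_itvoo R (f w - e) (f w); first by rewrite gtrBl.
rewrite in_itv /= => /andP[h1 h2].
have qr : q (pickle r) = ratr r by rewrite /q pickleK.
apply: (@le_trans _ _ (ratr r)%:E); first by rewrite -EFinB lee_fin ltW.
apply: ereal_sup_ubound; exists (pickle r) => //; rewrite /h qr mem_set//.
by apply/hw; rewrite qr.
Qed.

Lemma ae_factor_rV (R : realType) (d : nat) (d1 d2 : measure_display)
    (X : measurableType d1) (Z : measurableType d2)
    (P : {measure set X -> \bar R}) (Y : X -> Z) (f : X -> 'rV[R]_d) :
  (forall A, borel A -> exists2 C : set Z, measurable C &
    {ae P, forall w, A (f w) <-> C (Y w)}) ->
  exists2 beta : Z -> 'rV[R]_d,
    measurable_fun setT (beta : Z -> borel_rV R d) &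
    {ae P, forall w, beta (Y w) = f w}.
Proof.
move=> hf.
have /choice [b hb] : forall j, exists b : Z -> R, measurable_fun setT b /\
    {ae P, forall w, b (Y w) = f w ord0 j}.
  move=> j.
  have [r|b mb hb] := @ae_factor_real R _ _ X Z P Y (fun w => f w ord0 j).
    apply: (hf [set v | r < v ord0 j]).
    have := measurable_entry (R := R) j measurableT (measurable_itv `]r, +oo[).
    rewrite setTI; congr borel; apply/seteqP.
    by split=> v /=; rewrite in_itv /= andbT.
  by exists b.
exists (fun z => \row_j b j z).
  apply: measurable_rV => j; under eq_fun do rewrite mxE.
  by have [] := hb j.
have : {ae P, forall w j, b j (Y w) = f w ord0 j}.
  by apply: filter_forall => j; have [] := hb j.
by apply: filterS => w hw; apply/rowP => j; rewrite mxE.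
Qed.

Lemma measurable_dyadic_decreasing (R : realType) (d : nat) (T : R)
    (K : set 'rV[R]_d) (dz : measure_display) (Z : measurableType dz)
    (beta : R -> Z -> borel_rV R d) :
  closed K -> (forall q, measurable_fun setT (beta q)) ->
  measurable [set z | dyadic_decreasing T K (beta^~ z)].
Proof.
move=> clK mb.
have mK : measurable (K : set (borel_rV R d)).
  rewrite -[K]setCK; apply: measurableC; apply: sub_sigma_algebra.
  exact: closed_openC.
rewrite (_ : [set _ | _] = \bigcap_n \bigcap_k \bigcap_m \bigcap_l
   [set z | dyadic T n k <= dyadic T m l ->
     K (beta (dyadic T n k) z - beta (dyadic T m l) z : 'rV[R]_d)]).
  apply: bigcapT_measurable => n; apply: bigcapT_measurable => k.
  apply: bigcapT_measurable => m; apply: bigcapT_measurable => l.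
  have [le|nle] := boolP (dyadic T n k <= dyadic T m l); last first.
    by rewrite (_ : [set _ | _] = setT)//; apply/seteqP; split.
  have mD : measurable_fun setT (fun z =>
      beta (dyadic T n k) z - beta (dyadic T m l) z : borel_rV R d).
    apply: measurable_rV => j; under eq_fun do rewrite !mxE.
    by apply: measurable_funB;
      exact: (measurableT_comp (measurable_entry (R := R) j) (mb _)).
  have := mD measurableT _ mK; rewrite setTI; congr measurable.
  by apply/seteqP; split => z /= h; [move=> _|]; exact: h.
by apply/seteqP; split => z h n *; [move=> k _ m _ l _|]; exact: h.
Qed.

Lemma measurable_regularize (R : realType) (d : nat) (T : R)
    (dz : measure_display) (Z : measurableType dz)
    (beta : R -> Z -> borel_rV R d) :
  (forall q, measurable_fun setT (beta q)) ->
  measurable_fun setT (fun z => regularize T (beta^~ z) : path_space d T).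
Proof.
move=> mb; apply: measurable_path => t tT; apply: measurable_rV => j.
under eq_fun do rewrite mxE.
apply: measurable_real_limsup => n.
exact: (measurableT_comp (measurable_entry (R := R) j)).
Qed.

Lemma strategy_factor (R : realType) (p d : nat) (T : R) (K : set 'rV[R]_d)
    (M : market_model p d T) (B : Omega M -> R -> 'rV[R]_d) :
  0 < T -> closed K -> convex_cone K -> proper_cone K ->
  strategy K B ->
  exists b : path_space p T -> path_space d T,
    [/\ measurable_fun setT b, forall y, cone_decreasing_paths T K (b y) &
      {ae prob M, forall w t, 0 <= t <= T -> b (driving w) t = B w t}].
Proof.
move=> T0 clK cK pK [aB hB].
have K0 := proper_cone0 pK.
have /choice [beta hbeta] : forall q : R,
    exists beta : path_space p T -> 'rV[R]_d,
    measurable_fun setT (beta : path_space p T -> borel_rV R d) /\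
    (0 <= q <= T -> {ae prob M, forall w, beta (driving w) = B w q}).
  move=> q; have [qT|nqT] := boolP (0 <= q <= T); last first.
    by exists (fun=> 0); split => //; exact: measurable_cst.
  have [A bA|b mb hb] := @ae_factor_rV R d _ _ (Omega M) (path_space p T)
      (prob M) (driving (m := M)) (fun w => B w q).
    have [C sC hC] := filtration_factor qT (aB q qT A bA).
    have /andP[_ q1] := qT.
    by exists C => //; exact: cylinders_upto_measurable sC.
  by exists b.
pose good := [set y | dyadic_decreasing T K (beta^~ y)].
have mgood : measurable good.
  by apply: measurable_dyadic_decreasing => // q; have [] := hbeta q.
(* Replacing bad paths by the constant 0 makes the result [K]-decreasing for every [y]: strategies
   of another model must have such paths surely, not just almost surely. *)
pose beta0 q y := if y \in good then beta q y else 0.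
have dbeta0 y : dyadic_decreasing T K (beta0^~ y).
  move=> n k m l le; rewrite /beta0; case: ifPn => [|_]; last by rewrite subrr.
  by rewrite inE => /(_ n k m l le).
exists (fun y => regularize T (beta0^~ y)); split.
- apply: (measurable_regularize (beta := beta0)) => q.
  apply: measurable_fun_ifT.
  + apply: (measurable_fun_bool true); rewrite setTI.
    rewrite (_ : _ @^-1` _ = good) //.
    by apply/seteqP; split => z /= => [/set_mem|/mem_set].
  + by have [] := hbeta q.
  + exact: measurable_cst.
- by move=> y; split; [exact: (regularize_rcll clK cK pK)|
    exact: (regularize_decreasing clK cK pK)].
(* One null set serves all dyadic times; right continuity of [B w] then recovers every [t] at
   once. *)
- have : {ae prob M, forall w n k,
      beta (dyadic T n k) (driving w) = B w (dyadic T n k)}.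
    apply/ae_foralln => n; apply/ae_foralln => k.
    by have [_] := hbeta (dyadic T n k); apply; exact: dyadic_itv.
  apply: filterS => w hw t tT.
  have [rB dB] := hB w.
  apply: regularize_id => // n k; rewrite /beta0 mem_set ?hw//.
  move=> n' k' m l le; rewrite !hw -opprB; apply: dB => //.
    by have /andP[] := dyadic_itv n' k' T0.
  by have /andP[] := dyadic_itv m l T0.
Qed.

Lemma same_law_sym (R : realType) (p d : nat) (T : R)
    (M M' : market_model p d T) :
  same_law M M' -> same_law M' M.
Proof. by move=> h A mA; rewrite h. Qed.

Lemma measurable_model (R : realType) (p d : nat) (T : R)
    (M : market_model p d T) :
  measurable_fun setT (fun w : Omega M =>
    (price w, driving w) : path_space d T * path_space p T).
Proof.
apply: measurable_fun_prod; first exact: measurable_adapted (price_adapted M).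
exact: measurable_driving.
Qed.

Lemma same_law_ae (R : realType) (p d : nat) (T : R) (M M' : market_model p d T)
    (A : set (path_space d T * path_space p T)) :
  same_law M M' -> measurable A ->
  {ae prob M, forall w, A (price w, driving w)} ->
  {ae prob M', forall w, A (price w, driving w)}.
Proof.
move=> lawE mA [N [mN N0 AN]].
pose E (L : market_model p d T) := [set w : Omega L | ~ A (price w, driving w)].
have mE L : measurable (E L).
  have := @measurable_model R p d T L measurableT _ (measurableC mA).
  by rewrite setTI.
exists (E M'); split => //.
have := lawE _ (measurableC mA); rewrite /model_law /pushforward => <-.
by apply: (subset_measure0 (mE M) mN AN N0).
Qed.

(** Adaptedness is the point: a representation of the event at time [t] by the path up to [t] holds
    almost surely in [M], and as a property of the law it carries over to [M']. *)
Lemma strategy_transfer (R : realType) (p d : nat) (T : R) (K : set 'rV[R]_d)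
    (M M' : market_model p d T) (B : Omega M -> R -> 'rV[R]_d)
    (b : path_space p T -> path_space d T) :
  same_law M M' -> strategy K B ->
  measurable_fun setT b -> (forall y, cone_decreasing_paths T K (b y)) ->
  {ae prob M, forall w t, 0 <= t <= T -> b (driving w) t = B w t} ->
  strategy K (fun w : Omega M' => b (driving w)).
Proof.
move=> lawE [aB _] mb hb bB; split => // t tT A bA.
have [C sC hC] := filtration_factor tT (aB t tT A bA).
have /andP[_ leT] := tT.
have mC := cylinders_upto_measurable leT sC.
have mbA : measurable [set y | A (b y t)].
  have := measurableT_comp (measurable_eval (n := d) tT) mb.
  move=> /(_ measurableT A bA).
  by rewrite setTI.
have mF : measurable [set w : Omega M' | A (b (driving w) t)].
  by have := @measurable_driving R p d T M' measurableT _ mbA; rewrite setTI.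
apply: (filtration_preimage tT sC mF).
(* The paths on which looking up to time [t] suffices to decide the event. *)
pose D := [set y | A (b y t) <-> C y].
have mD : measurable D.
  rewrite (_ : D = ([set y | A (b y t)] `&` C) `|`
                   (~` [set y | A (b y t)] `&` ~` C)).
    by apply: measurableU; apply: measurableI => //; exact: measurableC.
  apply/seteqP; split => y; rewrite /D /=; last tauto.
  by have [?|?] := pselect (C y); tauto.
(* The law of the driving process is used as a marginal of the joint law. *)
have hD : {ae prob M, forall w, (setT `*` D) (price w, driving w)}.
  by apply: filterS2 bB hC => w /(_ t tT) bw Cw; split => //; rewrite /D /= bw.
have := same_law_ae lawE (measurableX measurableT mD) hD.
by apply: filterS => w [].
Qed.

(** * Transfer between models *)

(** No integrability is assumed: positive and negative parts are transferred separately by change of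
    variables, so the convention for the difference of infinities is respected. *)
Lemma same_law_integral (R : realType) (p d : nat) (T : R)
    (M M' : market_model p d T)
    (G : path_space d T * path_space p T -> \bar R) :
  same_law M M' -> measurable_fun setT G ->
  (\int[prob M]_w G (price w, driving w) =
   \int[prob M']_w G (price w, driving w))%E.
Proof.
move=> lawE mG.
have ge0 (H : path_space d T * path_space p T -> \bar R) :
    measurable_fun setT H -> (forall z, 0 <= H z)%E ->
    (\int[prob M]_w H (price w, driving w) =
     \int[prob M']_w H (price w, driving w))%E.
  move=> mH H0.
  have h L := @ge0_integral_pushforward _ _ _ _ R _
    (@measurable_model R p d T L) (prob L) setT H measurableT mH
    (fun z _ => H0 z).
  have := h M; have := h M'; rewrite !preimage_setT => <- <-.
  unshelve eapply eq_measure_integral; [exact: measurable_model..|].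
  by move=> A mA _; exact: lawE.
pose W (L : market_model p d T) (w : Omega L) :
  path_space d T * path_space p T := (price w, driving w).
have pE (L : market_model p d T) : (\int[prob L]_w (G \o W L)^\+ w =
    \int[prob L]_w G^\+ (price w, driving w))%E.
  by apply: eq_integral => w _; rewrite !funeposE.
have nE (L : market_model p d T) : (\int[prob L]_w (G \o W L)^\- w =
    \int[prob L]_w G^\- (price w, driving w))%E.
  by apply: eq_integral => w _; rewrite !funenegE.
rewrite integralE [RHS]integralE (pE M) (pE M') (nE M) (nE M').
by congr (_ - _)%E; apply: ge0 => //;
  [exact: measurable_funepos|exact: measurable_funeneg].
Qed.

(** Bridges the gap that [b] composed with the driving process agrees with [B] on [[0, T]] only, not
    as a function on all reals. *)
Lemma eq_wealth_limsup (R : realType) (d : nat) (T t : R) (x : 'rV[R]_d)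
    (s b b' : R -> 'rV[R]_d) : 0 <= t <= T ->
  (forall r, 0 <= r <= T -> b r = b' r) ->
  wealth_limsup x s b t = wealth_limsup x s b' t.
Proof.
move=> /andP[t0 tT] bb'; apply/rowP => j; rewrite !mxE.
rewrite bb' ?lexx ?(le_trans t0)//.
suff -> : unif_sum 0 t (fun r => (s r ord0 j)^-1) (fun r => b r ord0 j) =
    unif_sum 0 t (fun r => (s r ord0 j)^-1) (fun r => b' r ord0 j) by [].
apply/funext => n; apply: eq_big_nat => i /andP[_ ni].
have uT k : (k <= n.+1)%N -> 0 <= unif_point 0 t n k <= T.
  by move=> nk; have /andP[-> /= /le_trans->] := unif_point_itv t0 nk.
by rewrite !bb'// uT// ltnW.
Qed.

(** Extending [U] by 0 outside [K] removes the dependence of the integration domain on the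
    strategy. *)
Lemma expected_utilityE (R : realType) (p d : nat) (T : R) (K : set 'rV[R]_d)
    (U : 'rV[R]_d -> \bar R) (M : market_model p d T) (x : 'rV[R]_d)
    (B : Omega M -> R -> 'rV[R]_d) :
  expected_utility K U x B = (\int[prob M]_w (U \_ K) (wealth x B w T))%E.
Proof.
rewrite /expected_utility integral_mkcond; apply: eq_integral => w _.
by rewrite !patchE; congr (if _ then _ else _); apply/idP/idP => /[!inE].
Qed.

Lemma bellman_le (R : realType) (p d : nat) (T : R) (K : set 'rV[R]_d)
    (U : 'rV[R]_d -> \bar R) (M M' : market_model p d T) (x : 'rV[R]_d) :
  0 < T -> closed K -> convex_cone K -> proper_cone K ->
  measurable_fun (K : set (borel_rV R d)) U -> same_law M M' ->
  (bellman K U x M <= bellman K U x M')%E.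
Proof.
move=> T0 clK cK pK mU lawE.
apply: ge_ereal_sup => _ [B [sB adB] <-].
have [aB hB] := sB.
have [b [mb hb bB]] := strategy_factor T0 clK cK pK sB.
pose B' (w : Omega M') := b (driving w).
have mK : measurable (K : set (borel_rV R d)).
  rewrite -[K]setCK; apply: measurableC; apply: sub_sigma_algebra.
  exact: closed_openC.
have TT : 0 <= T <= T by rewrite lexx ltW.
have wE (L : market_model p d T) (C : Omega L -> R -> 'rV[R]_d) w t :
    0 <= t <= T -> cone_decreasing_paths T K (C w) ->
    wealth x C w t = wealth_limsup x (price w) (C w) t.
  move=> tT [_ dC]; rewrite wealthE; apply: path_wealthE dC => //.
    exact: price_continuous.
  by move=> r j rT; exact: price_gt0.
pose Phi t (z : path_space d T * path_space p T) : borel_rV R d :=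
  wealth_limsup x z.1 (b z.2) t.
have mPhi t : 0 <= t <= T -> measurable_fun setT (Phi t).
  move=> tT; apply: measurable_wealth_limsup => //.
  by apply: measurableT_comp => //; exact: measurable_snd.
(* In [M] the wealth is this functional of the two paths almost surely; in [M'] it is so everywhere,
   because [B'] is defined through [b]. *)
have BE : {ae prob M, forall w t, 0 <= t <= T ->
    wealth x B w t = Phi t (price w, driving w)}.
  apply: filterS bB => w bw t tT; rewrite wE//.
  apply: (eq_wealth_limsup _ _ tT).
  by move=> r rT; rewrite bw.
have BE' w t : 0 <= t <= T -> wealth x B' w t = Phi t (price w, driving w).
  by move=> tT; rewrite wE//; exact: hb.
have adB' : admissible K M' x B'.
  split; first exact: strategy_transfer bB.
  move=> t tT.
  have mA : measurable (Phi t @^-1` K).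
    by rewrite -[X in measurable X]setTI; exact: mPhi.
  have hA : {ae prob M, forall w, (Phi t @^-1` K) (price w, driving w)}.
    by apply: filterS2 BE (adB t tT) => w wE' /=; rewrite wE'.
  by apply: filterS (same_law_ae lawE mA hA) => w /=; rewrite BE'.
have mUK : measurable_fun setT (U \_ K : borel_rV R d -> \bar R).
  exact: ((@measurable_restrictT _ _ (borel_rV R d) (\bar R) K U mK).1 mU).
have mUPhi : measurable_fun setT ((U \_ K) \o Phi T).
  exact: (measurableT_comp mUK (mPhi T TT)).
suff -> : expected_utility K U x B = expected_utility K U x B'.
  by apply: ereal_sup_ubound; exists B'.
rewrite !expected_utilityE.
under [RHS]eq_integral do rewrite BE'//.
rewrite -(same_law_integral lawE mUPhi).
(* Almost sure equality suffices once both integrands are measurable; for [B] this follows from its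
   own adaptedness through [wealth_limsup]. *)
apply: ae_eq_integral => //.
- have mS := measurable_adapted (price_adapted M).
  have mB := measurable_adapted aB.
  have := measurableT_comp mUK (measurable_wealth_limsup x TT mS mB).
  by apply: eq_measurable_fun => w _; rewrite /= wE.
- exact: (measurableT_comp mUPhi (measurable_model (M := M))).
- by apply: filterS BE => w wE' _; rewrite /= wE'.
Qed.

Theorem theorem3p3 (R : realType) (p d : nat) (T : R)
    (K : set 'rV[R]_d) (U : 'rV[R]_d -> \bar R)
    (p_gt0 : (0 < p)%N) (d_gt0 : (0 < d)%N) (T_gt0 : 0 < T)
    (K_closed : closed K) (K_cone : convex_cone K) (K_proper : proper_cone K)
    (K_orthant : forall v : 'rV[R]_d, (forall j, 0 < v ord0 j) -> K v)
    (U_lty : forall v, K v -> (U v < +oo)%E)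
    (U_borel : measurable_fun (K : set (borel_rV R d)) U)
    (M M' : market_model p d T) (lawE : same_law M M') :
  forall x : 'rV[R]_d, K x -> bellman K U x M = bellman K U x M'.
Proof.
move=> x _; apply/eqP; rewrite eq_le.
apply/andP; split; apply: bellman_le => //.
exact: same_law_sym.
Qed.
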